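(* Let $(\mathcal A,\alpha)$ be an operator ideal. A Banach space $X$ has the $\mathcal A$-approximation property if and only if for every Banach space $Y$ we have $$\mathcal A\circ\mathcal K(Y,X)\subset\overline{\mathcal F(Y,X)}^{\alpha_\kappa},$$ i.e. the finite rank operators are dense in $\mathcal A\circ\mathcal K(Y,X)$ with respect to $\alpha_\kappa$.
   Context: Operator ideals are quasi-normed operator ideals $(\mathcal A,\alpha)$ between Banach spaces in the sense of Pietsch. $\mathcal K$ and $\mathcal F$ denote the compact and the finite rank operators. $B_X$ is the closed unit ball of $X$. Composition: $T\in\mathcal A\circ\mathcal K(X,Y)$ iff $T=T_1\circ T_2$ with $T_2\in\mathcal K(X,Z)$, $T_1\in\mathcal A(Z,Y)$ for some Banach space $Z$; the composition norm is $\alpha_\kappa(T)=\inf\{\alpha(T_1)\|T_2\|\}$ over all such factorizations. $\mathcal A$-approximation property: for a compact subset $K$ of a Banach space $E$, call a Banach space $Z$ admissible for $(E,K)$ if $Z$ is a linear subspace of $E$ with its own complete norm such that the formal inclusion $i_Z:Z\to E$ is a compact operator, $K\subset i_Z(B_Z)$, and for every $g\in Z^*$ and $\epsilon>0$ there is $f\in E^*$ with $|f(z)-g(z)|<\epsilon$ for all $z\in B_Z$ (by an observation of Grothendieck, such $Z$ always exist). For $T\in\mathcal A(E,G)$ put $\|T\|_K=\inf\{\alpha_\kappa(T\circ i_Z): Z\text{ admissible for }(E,K)\}$. The family $\{\|\cdot\|_K: K\subset E\text{ compact}\}$ defines the topology $\lambda_{\mathcal A}$ on $\mathcal A(E,G)$.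 A Banach space $X$ has the $\mathcal A$-approximation property if for every Banach space $Y$, $\mathcal F(Y,X)$ is dense in $\mathcal A(Y,X)$ in the topology $\lambda_{\mathcal A}$. *)

(* Defs.v *)
From HB Require Import structures.
From mathcomp Require Import all_boot all_order all_algebra.
From mathcomp Require Import complex.
From mathcomp Require Import all_classical all_reals all_analysis.

Set Implicit Arguments.
Unset Strict Implicit.
Unset Printing Implicit Defensive.

Import Order.TTheory GRing.Theory Num.Theory.
Import numFieldNormedType.Exports.

Local Open Scope classical_set_scope.
Local Open Scope ring_scope.

(* Banach spaces are real or complex; both cases are treated at once. *)
Inductive scalars := RealScalars | ComplexScalars.

Definition scalar_field (R : realType) (s : scalars) : numFieldType :=
  match s with RealScalars => R | ComplexScalars => R[i] end.

Definition real_part (R : realType) (s : scalars) : scalar_field R s -> R :=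
  match s with RealScalars => id | ComplexScalars => @complex.Re R end.

Section ComplexComplete.
Variable R : realType.

Lemma complex_cauchy_cvg (F : set_system R[i]^o) :
  ProperFilter F -> cauchy F -> cvg F.
Proof.
move=> FF /cauchy_ballP Fc.
have part (p : R[i]^o -> R^o) :
    (forall x y, (`|p x - p y|%:C <= `|x - y|)%C) -> cvg (p @ F).
  move=> ple; apply: cauchy_cvg; apply/cauchy_ballP => e e0.
  have e0' : 0 < e%:C%C :> R[i] by rewrite ltcR.
  have [[U V] /= [FU FV] UV] := Fc _ e0'.
  exists (p @` U, p @` V) => /=.
    by split; [apply: filterS FU|apply: filterS FV] => x Ux; exists x.
  move=> [_ _] /= [[x Ux <-] [y Vy <-]].
  have := UV (x, y) (conj Ux Vy).
  rewrite -!ball_normE /= => h.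
  by have := le_lt_trans (ple x y) h; rewrite ltcR.
have /cvg_ex[a /fcvgrPdist_lt cRe] : cvg ((@complex.Re R : R[i]^o -> R^o) @ F).
  by apply: part => x y; rewrite -raddfB; exact: normc_ge_Re.
have /cvg_ex[b /fcvgrPdist_lt cIm] : cvg ((@complex.Im R : R[i]^o -> R^o) @ F).
  apply: part => x y; rewrite -raddfB.
  rewrite normc_def lecR -sqrtr_sqr ler_sqrt ?addr_ge0 ?sqr_ge0//.
  by rewrite lerDr sqr_ge0.
apply/cvg_ex; exists ((a +i* b)%C : R[i]^o); apply/fcvgrPdist_lt => e e0.
have [r r0 re] : exists2 r : R, 0 < r & e = (r%:C)%C.
  case: e e0 => x y; rewrite ltcE /= => /andP[/eqP -> x0].
  by exists x.
have r2 : 0 < r / 2 by rewrite divr_gt0.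
have decomp (z : R[i]) : (a +i* b)%C - z =
    ((a - complex.Re z)%:C + 'i * (b - complex.Im z)%:C)%C.
  by case: z => x y; simpc.
near=> z.
have h1 : `|a - complex.Re z| < r / 2 by near: z; exact: cRe.
have h2 : `|b - complex.Im z| < r / 2 by near: z; exact: cIm.
rewrite (decomp z).
apply: le_lt_trans (ler_normD _ _) _.
rewrite normrM !normc_def /= !expr0n !expr1n /= add0r !addr0 sqrtr1 mul1r !sqrtr_sqr.
by rewrite -rmorphD /= re ltcR (splitr r) ltrD.
Unshelve. all: by end_near.
Qed.

(* Not a canonical instance: R^o for R : realType already uses the key. *)
Definition complex_space : completeNormedModType R[i] :=
  HB.pack (R[i]^o) (Uniform_isComplete.Build R[i]^o complex_cauchy_cvg).

End ComplexComplete.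

Definition banach (R : realType) (s : scalars) :=
  completeNormedModType (scalar_field R s).

Definition scalar_space (R : realType) (s : scalars) : banach R s :=
  match s return banach R s with
  | RealScalars => R^o
  | ComplexScalars => complex_space R
  end.

Section Operators.
Context {R : realType} {s : scalars}.

(* norms take values in the scalar field; rnorm is their real value *)
Definition rnorm {X : banach R s} (x : X) : R := real_part `|x|.

Definition unit_ball (X : banach R s) : set X := [set x | rnorm x <= 1].
Arguments unit_ball : clear implicits.

Definition bounded_operator {X Y : banach R s} (T : X -> Y) : Prop :=
  linear T /\ continuous T.

Definition opnorm {X Y : banach R s} (T : X -> Y) : R :=
  sup [set rnorm (T x) | x in unit_ball X].

Definition compact_operator {X Y : banach R s} (T : X -> Y) : Prop :=
  linear T /\ compact (closure (T @` unit_ball X)).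

Definition finite_rank (X Y : banach R s) : set (X -> Y) :=
  [set T | bounded_operator T /\
    exists (n : nat) (y : 'I_n -> Y), forall x : X,
      exists c : 'I_n -> scalar_field R s, T x = \sum_(i < n) c i *: y i].
Arguments finite_rank : clear implicits.

Definition dual (X : banach R s) : set (X -> scalar_space R s) :=
  [set f | bounded_operator f].
Arguments dual : clear implicits.

End Operators.

Arguments unit_ball {R s} X.
Arguments dual {R s} X.
Arguments finite_rank {R s} X Y.

(* Pietsch's axioms (OI0)-(OI2) and (QOI0)-(QOI2).  Homogeneity of the
   quasi-norm and its definiteness follow from (QOI0) and (QOI2).  The
   completeness of the components with respect to the quasi-norm is not
   required, so ideals with and without it are covered. *)
Record quasi_normed_ideal (R : realType) (s : scalars) := QuasiNormedIdeal {
  ideal_mem : forall X Y : banach R s, set (X -> Y);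
  ideal_qnorm : forall X Y : banach R s, (X -> Y) -> R;
  ideal_bounded : forall (X Y : banach R s) (T : X -> Y),
    ideal_mem T -> bounded_operator T;
  ideal_id : ideal_mem (@id (scalar_space R s));
  ideal_add : forall (X Y : banach R s) (S T : X -> Y),
    ideal_mem S -> ideal_mem T -> ideal_mem (S \+ T);
  ideal_comp : forall (X0 X Y Y0 : banach R s)
      (T : X0 -> X) (S : X -> Y) (U : Y -> Y0),
    bounded_operator T -> ideal_mem S -> bounded_operator U ->
    ideal_mem (U \o S \o T);
  ideal_qnorm_ge0 : forall (X Y : banach R s) (T : X -> Y),
    ideal_mem T -> 0 <= ideal_qnorm T;
  ideal_qnorm_id : ideal_qnorm (@id (scalar_space R s)) = 1;
  ideal_qnorm_add : exists2 k : R, 1 <= k &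
    forall (X Y : banach R s) (S T : X -> Y),
      ideal_mem S -> ideal_mem T ->
      ideal_qnorm (S \+ T) <= k * (ideal_qnorm S + ideal_qnorm T);
  ideal_qnorm_comp : forall (X0 X Y Y0 : banach R s)
      (T : X0 -> X) (S : X -> Y) (U : Y -> Y0),
    bounded_operator T -> ideal_mem S -> bounded_operator U ->
    ideal_qnorm (U \o S \o T) <= opnorm U * ideal_qnorm S * opnorm T
}.

Arguments ideal_mem {R s} _ {X Y}.
Arguments ideal_qnorm {R s} _ {X Y}.

Section ApproximationProperty.
Context {R : realType} {s : scalars} (A : quasi_normed_ideal R s).

Definition factorization (X Y Z : banach R s) (T : X -> Y)
    (T1 : Z -> Y) (T2 : X -> Z) : Prop :=
  [/\ ideal_mem A T1, compact_operator T2 & T = T1 \o T2].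

Definition comp_compact (X Y : banach R s) : set (X -> Y) :=
  [set T | exists (Z : banach R s) (T1 : Z -> Y) (T2 : X -> Z),
     factorization T T1 T2].

(* An extended real infimum, hence +oo when T is not in the composition
   ideal: inf set0 = 0 in R would be misleading here. *)
Definition alpha_kappa {X Y : banach R s} (T : X -> Y) : \bar R :=
  ereal_inf [set a | exists (Z : banach R s) (T1 : Z -> Y) (T2 : X -> Z),
    factorization T T1 T2 /\ a = (ideal_qnorm A T1 * opnorm T2)%:E].

(* A linear subspace Z of E with its own complete norm is given as a Banach
   space Z with an injective linear map i : Z -> E, its formal inclusion. *)
Definition admissible (E : banach R s) (K : set E)
    (Z : banach R s) (i : Z -> E) : Prop :=
  [/\ injective i, compact_operator i, K `<=` i @` unit_ball Z &
    forall g, dual Z g -> forall eps : R, 0 < eps ->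
      exists2 f, dual E f &
        forall z, unit_ball Z z -> rnorm (f (i z) - g z) < eps].

Definition norm_on (E G : banach R s) (K : set E) (T : E -> G) : \bar R :=
  ereal_inf [set a | exists (Z : banach R s) (i : Z -> E),
    admissible K i /\ a = alpha_kappa (T \o i)].

(* The neighbourhoods of T in A(E, G) for the topology defined by the family
   norm_on K, K compact: the supersets in A(E, G) of finite intersections of
   balls centred at T. *)
Definition lambda_nbhs (E G : banach R s) (T : E -> G) :
    set_system (E -> G) :=
  [set U | U `<=` ideal_mem A /\
    exists (n : nat) (K : 'I_n -> set E) (eps : R),
    [/\ 0 < eps, forall j, compact (K j) &
      forall S, ideal_mem A S ->
        (forall j, (norm_on (K j) (S \- T)%R < eps%:E)%E) -> U S]].

Definition lambda_dense (E G : banach R s) (D : set (E -> G)) : Prop :=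
  forall T, ideal_mem A T -> forall U, lambda_nbhs T U -> U `&` D !=set0.

Definition approximation_property (X : banach R s) : Prop :=
  forall Y : banach R s, lambda_dense (finite_rank Y X).

Definition alpha_kappa_closure (X Y : banach R s) (D : set (X -> Y)) :
    set (X -> Y) :=
  [set T | forall eps : R, 0 < eps ->
    exists2 S, D S & (alpha_kappa (T \- S)%R < eps%:E)%E].

End ApproximationProperty.

Arguments comp_compact {R s} A X Y.
Arguments alpha_kappa_closure {R s} A {X Y} D.

(* Main.v *)
(** Compact operators factor through a given admissible space, so approximating
    [T1] in the topology of compact sets approximates every [T1 \o T2] with [T2]
    compact; this gives one direction.  Conversely, let [i : Z -> Y] be admissible
    for a compact set; an approximation of [T \o i] by a finite rank [S] is turned
    into one of the form [S' \o i] by approximating the finitely many coordinate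
    functionals of [S], elements of [Z^*], by elements of [Y^*].  The error is a
    finite sum of small rank one operators, each of which factors compactly
    through the scalars.

    An admissible space is obtained by a c_0 version of the interpolation
    construction of Davis, Figiel, Johnson and Pelczynski: equivalent norms [p n]
    on [E] tend to [0] on [K], and [Z] consists of the [x] with [p n x] tending to
    [0], normed by [sup_n p n x].  A sliding hump argument bounds each [g] in
    [Z^*] by [M * |i z|_E + e * |z|_Z], and Hahn-Banach on [E * Z] then yields a
    functional on [E] within [e] of [g] on the unit ball of [Z]. *)
Require Import Defs.
From HB Require Import structures.
From mathcomp Require Import all_boot all_order all_algebra.
From mathcomp Require Import complex.
From mathcomp Require Import all_classical all_reals all_analysis.
From mathcomp Require Import ring lra.

Set Implicit Arguments.
Unset Strict Implicit.
Unset Printing Implicit Defensive.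

Import Order.TTheory GRing.Theory Num.Theory.
Import numFieldNormedType.Exports.

Local Open Scope classical_set_scope.
Local Open Scope ring_scope.

(** * Real-valued norms and real radii over either scalar field *)

Section RealValuedNorm.
Context {R : realType} {s : scalars}.
Local Notation K := (scalar_field R s).
Implicit Types X Y Z : banach R s.

(** A section of [real_part]. It preserves and reflects the order and every norm lies in its image,
    so inequalities between norms can be moved from the scalar field to [R]. *)
Definition of_real (r : R) : K :=
  match s return scalar_field R s with
  | RealScalars => r | ComplexScalars => (r%:C)%C end.

Lemma real_partK (r : R) : real_part (of_real r) = r.
Proof. by rewrite /of_real /real_part; case: s. Qed.

Lemma of_realD (x y : R) : of_real (x + y) = of_real x + of_real y.
Proof. by rewrite /of_real; case: s => //=; rewrite rmorphD. Qed.

Lemma of_realM (x y : R) : of_real (x * y) = of_real x * of_real y.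
Proof. by rewrite /of_real; case: s => //=; rewrite rmorphM. Qed.

Lemma of_real0 : of_real 0 = 0.
Proof. by rewrite /of_real; case: s. Qed.

Lemma of_real1 : of_real 1 = 1.
Proof. by rewrite /of_real; case: s. Qed.

Lemma of_realN (x : R) : of_real (- x) = - of_real x.
Proof. by rewrite /of_real; case: s => //=; rewrite rmorphN. Qed.

Lemma ler_of_real (x y : R) : (of_real x <= of_real y) = (x <= y).
Proof. by rewrite /of_real; case: s => //=; rewrite lecR. Qed.

Lemma ltr_of_real (x y : R) : (of_real x < of_real y) = (x < y).
Proof. by rewrite /of_real; case: s => //=; rewrite ltcR. Qed.

Lemma norm_of_real (x : R) : `|of_real x| = of_real `|x|.
Proof.
have [x0|x0] := leP 0 x.
  by rewrite !ger0_norm// -of_real0 ler_of_real.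
by rewrite !ltr0_norm ?of_realN// -of_real0 ltr_of_real.
Qed.

Lemma of_real_ge0 (c : K) : 0 <= c -> c = of_real (real_part c).
Proof.
rewrite /of_real /real_part; move: c; case: s => //= c.
by case: c => x y; rewrite lecE /= => /andP[/eqP -> _].
Qed.

Definition cabs (c : K) : R := real_part `|c|.

Lemma of_real_cabs (c : K) : of_real (cabs c) = `|c|.
Proof. by rewrite /cabs -of_real_ge0 ?normr_ge0. Qed.

Lemma of_real_rnorm X (x : X) : of_real (rnorm x) = `|x|.
Proof. by rewrite /rnorm -of_real_ge0 ?normr_ge0. Qed.

Lemma of_real_inj : injective of_real.
Proof. by move=> x y /(congr1 (@real_part R s)); rewrite !real_partK. Qed.

Lemma cabs_ge0 c : 0 <= cabs c.
Proof. by rewrite -ler_of_real of_real_cabs of_real0. Qed.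

Lemma cabsM a b : cabs (a * b) = cabs a * cabs b.
Proof. by apply: of_real_inj; rewrite of_realM !of_real_cabs normrM. Qed.

Lemma cabsD a b : cabs (a + b) <= cabs a + cabs b.
Proof. by rewrite -ler_of_real of_realD !of_real_cabs ler_normD. Qed.

Lemma cabs_real r : cabs (of_real r) = `|r|.
Proof. by apply: of_real_inj; rewrite of_real_cabs norm_of_real. Qed.

Lemma cabsV a : cabs a^-1 = (cabs a)^-1.
Proof.
have [->|a0] := eqVneq a 0.
  by rewrite invr0 -of_real0 cabs_real normr0 invr0.
have ca : cabs a != 0.
  by apply: contra a0 => /eqP h; rewrite -normr_eq0 -of_real_cabs h of_real0.
by apply: (mulIf ca); rewrite -cabsM !mulVf// -of_real1 cabs_real normr1.
Qed.

Lemma rnorm_ge0 X (x : X) : 0 <= rnorm x.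
Proof. by rewrite -ler_of_real of_real_rnorm of_real0. Qed.

Lemma rnormD X (x y : X) : rnorm (x + y) <= rnorm x + rnorm y.
Proof. by rewrite -ler_of_real of_realD !of_real_rnorm ler_normD. Qed.

Lemma rnormZ X (c : K) (x : X) : rnorm (c *: x) = cabs c * rnorm x.
Proof.
by apply: of_real_inj; rewrite of_realM of_real_cabs !of_real_rnorm normrZ.
Qed.

Lemma rnorm0 X : rnorm (0 : X) = 0.
Proof. by apply: of_real_inj; rewrite of_real_rnorm normr0 of_real0. Qed.

Lemma rnorm_eq0 X (x : X) : rnorm x = 0 -> x = 0.
Proof. by move=> h; apply/normr0_eq0; rewrite -of_real_rnorm h of_real0. Qed.

Lemma rnormN X (x : X) : rnorm (- x) = rnorm x.
Proof. by apply: of_real_inj; rewrite !of_real_rnorm normrN. Qed.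

Lemma rdistC X (x y : X) : rnorm (x - y) = rnorm (y - x).
Proof. by rewrite -rnormN opprB. Qed.

Lemma rnormB X (x y : X) : rnorm (x - y) <= rnorm x + rnorm y.
Proof. by rewrite (le_trans (rnormD _ _))// rnormN. Qed.

Lemma rdist_triangle X (z x y : X) :
  rnorm (x - y) <= rnorm (x - z) + rnorm (z - y).
Proof. by rewrite (le_trans _ (rnormD _ _))// addrA subrK. Qed.

Lemma pos_of_real (e : K) : 0 < e -> exists2 r : R, 0 < r & e = of_real r.
Proof.
move=> e0; have eE := of_real_ge0 (ltW e0).
by exists (real_part e) => //; rewrite -ltr_of_real -eE of_real0.
Qed.

Lemma nbhs_rnorm X (x : X) (A : set X) :
  nbhs x A <-> exists2 e : R, 0 < e & [set y | rnorm (x - y) < e] `<=` A.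
Proof.
split.
  move=> /nbhs_ballP[e /pos_of_real[r r0 ->] eA]; exists r => // y /= yr.
  by apply: eA; rewrite -ball_normE /= -of_real_rnorm ltr_of_real.
move=> [e e0 eA]; apply/nbhs_ballP; exists (of_real e).
  by rewrite /= -of_real0 ltr_of_real.
by move=> y; rewrite -ball_normE /= -of_real_rnorm ltr_of_real => /eA.
Qed.

Lemma cvg_rnorm X (F : set_system X) (FF : Filter F) (x : X) :
  F --> x <-> forall e : R, 0 < e -> F [set y | rnorm (x - y) < e].
Proof.
split=> [Fx e e0|h A /nbhs_rnorm[e e0 eA]].
  by apply: Fx; apply/nbhs_rnorm; exists e.
by apply: filterS eA _; exact: h.
Qed.

Lemma closure_rnorm X (A : set X) (x : X) :
  closure A x <-> forall e : R, 0 < e -> exists2 y, A y & rnorm (x - y) < e.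
Proof.
split=> [clA e e0|h B /nbhs_rnorm[e /h[y Ay xy] eB]].
  have /clA[y [Ay xy]] : nbhs x [set y | rnorm (x - y) < e].
    by apply/nbhs_rnorm; exists e.
  by exists y.
by exists y; split => //; exact: eB.
Qed.

(** Completeness in terms of filters and real radii. The hypothesis [N_complete] below has the same
    shape, so completeness of a constructed space can be derived from that of the given ones. *)
Lemma banach_complete X (F : set_system X) (FF : ProperFilter F) :
  (forall e : R, 0 < e -> exists x, F [set y | rnorm (x - y) < e]) ->
  exists x, forall e : R, 0 < e -> F [set y | rnorm (x - y) < e].
Proof.
move=> h; have : cauchy F.
  apply: cauchy_exP => _ /pos_of_real[r r0 ->]; have [x Fx] := h r r0.
  exists x; apply: filterS Fx => y; rewrite /= -ball_normE /=.
  by rewrite -of_real_rnorm ltr_of_real.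
by move=> /cauchy_cvg/cvg_ex[x /cvg_rnorm Fx]; exists x.
Qed.

End RealValuedNorm.

(** * Banach spaces from a complete real-valued norm on a vector space *)

Section MakeBanach.
Context {R : realType} {s : scalars}.
Local Notation K := (scalar_field R s).
Variables (V : lmodType K) (N : V -> R).
Hypothesis ND : forall x y, N (x + y) <= N x + N y.
Hypothesis NZ : forall (c : K) x, N (c *: x) = cabs c * N x.
Hypothesis N_eq0 : forall x, N x = 0 -> x = 0.
Hypothesis N_complete : forall F : set_system V, ProperFilter F ->
  (forall e : R, 0 < e -> exists x, F [set y | N (x - y) < e]) ->
  exists x, forall e : R, 0 < e -> F [set y | N (x - y) < e].

(** A separate name for the carrier keeps the structure given by [N] apart from any that [V] already
    carries, as a product of Banach spaces does. *)
Definition normed_alias : Type := V.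
HB.instance Definition _ := GRing.Lmodule.on normed_alias.

Definition alias_norm (x : normed_alias) : K := of_real (N x).

Lemma alias_normD x y : alias_norm (x + y) <= alias_norm x + alias_norm y.
Proof. by rewrite /alias_norm -of_realD ler_of_real ND. Qed.

Lemma alias_normZ (l : K) x : alias_norm (l *: x) = `|l| * alias_norm x.
Proof. by rewrite /alias_norm NZ of_realM of_real_cabs. Qed.

Lemma alias_norm_eq0 x : alias_norm x = 0 -> x = 0.
Proof. by rewrite /alias_norm -of_real0 => /of_real_inj /N_eq0. Qed.

HB.instance Definition _ := Lmodule_isNormed.Build K normed_alias
  alias_normD alias_normZ alias_norm_eq0.

Lemma alias_complete (F : set_system normed_alias) :
  ProperFilter F -> cauchy F -> cvg F.
Proof.
move=> FF /cauchyP Fc.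
have ballE (x y : normed_alias) (r : R) :
    ball x (of_real r : K) y <-> N (x - y) < r.
  by rewrite -ball_normE /= [X in X < _](_ : _ = of_real (N (x - y)))//
    ltr_of_real.
have [|x Fx] := @N_complete F FF.
  move=> e e0; have [|x Fx] := Fc (of_real e).
    by rewrite -of_real0 ltr_of_real.
  by exists x; apply: filterS Fx => y /ballE.
apply/cvg_ex; exists x => A /nbhs_ballP[e /pos_of_real[r r0 ->] eA].
by apply: filterS (Fx _ r0) => y /ballE /eA.
Qed.

Definition alias_banach : banach R s :=
  HB.pack normed_alias (Uniform_isComplete.Build normed_alias alias_complete).

(** Both maps are identities. The existential form hides the construction: later proofs know the new
    space only through its norm. *)
Lemma banach_of_norm : exists (Z : banach R s) (j : V -> Z) (k : Z -> V),
  [/\ linear j, cancel j k, cancel k j & forall v, rnorm (j v) = N v].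
Proof.
exists alias_banach, (fun v => v), (fun v => v); split=> // v.
by rewrite /rnorm [X in real_part X](_ : _ = of_real (N v))// real_partK.
Qed.

End MakeBanach.

(** * The scalar field as a Banach space *)

Section ScalarSpace.
Context {R : realType} {s : scalars}.
Local Notation K := (scalar_field R s).

(** The carriers of [scalar_space] and [scalar_field] agree only once [s] is a constructor; [sc_val]
    and [sc_of] are the identity maps between them for a variable [s]. *)
Definition sc_val : scalar_space R s -> K :=
  match s return scalar_space R s -> scalar_field R s with
  | RealScalars => id | ComplexScalars => id end.

Definition sc_of : K -> scalar_space R s :=
  match s return scalar_field R s -> scalar_space R s with
  | RealScalars => id | ComplexScalars => id end.

Lemma sc_valK : cancel sc_val sc_of.
Proof. by rewrite /sc_val /sc_of; case: s. Qed.

Lemma sc_ofK : cancel sc_of sc_val.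
Proof. by rewrite /sc_val /sc_of; case: s. Qed.

Lemma sc_val_linear a x y : sc_val (a *: x + y) = a * sc_val x + sc_val y.
Proof. by move: a x y; rewrite /sc_val; case: s. Qed.

Lemma sc_val0 : sc_val 0 = 0.
Proof.
have := sc_val_linear 1 0 0.
rewrite scaler0 addr0 mul1r => /eqP.
by rewrite -subr_eq0 opprD addrA subrr sub0r oppr_eq0 => /eqP.
Qed.

Lemma sc_valZ a x : sc_val (a *: x) = a * sc_val x.
Proof. by rewrite -[_ *: _]addr0 sc_val_linear sc_val0 addr0. Qed.

Lemma sc_valB x y : sc_val (x - y) = sc_val x - sc_val y.
Proof. by rewrite addrC -scaleN1r sc_val_linear mulN1r addrC. Qed.

Lemma cabs_sc_val x : cabs (sc_val x) = rnorm x.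
Proof. by move: x; rewrite /sc_val; case: s. Qed.

End ScalarSpace.

(** * Linear and bounded operators, total boundedness and compactness *)

Section Linear.
Context {K : numFieldType} {V W : lmodType K}.
Variable f : V -> W.
Hypothesis lf : linear f.

Lemma lin0 : f 0 = 0.
Proof.
have := lf 1 0 0; rewrite !scale1r addr0 => /(congr1 (fun t => t - f 0)).
by rewrite subrr addrK => /esym.
Qed.

Lemma linZ a x : f (a *: x) = a *: f x.
Proof. by have := lf a x 0; rewrite !addr0 lin0 addr0. Qed.

Lemma linD x y : f (x + y) = f x + f y.
Proof. by have := lf 1 x y; rewrite !scale1r. Qed.

Lemma linN x : f (- x) = - f x.
Proof. by rewrite -scaleN1r linZ scaleN1r. Qed.

Lemma linB x y : f (x - y) = f x - f y.
Proof. by rewrite linD linN. Qed.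

End Linear.

Lemma divr2_gt0 (R : realFieldType) (e : R) : 0 < e -> 0 < e / 2.
Proof. by move=> e0; rewrite divr_gt0. Qed.

Lemma linear_comp (K : numFieldType) (U V W : lmodType K) (f : V -> W)
  (g : U -> V) : linear f -> linear g -> linear (f \o g).
Proof. by move=> lf lg a x y /=; rewrite lg lf. Qed.

Section BoundedOperators.
Context {R : realType} {s : scalars}.
Local Notation K := (scalar_field R s).
Implicit Types X Y Z : banach R s.

Lemma unit_ball_scale X (x : X) (r : R) : 0 < r -> rnorm x <= r ->
  unit_ball X (of_real r^-1 *: x).
Proof.
move=> r0 xr; rewrite /unit_ball /= rnormZ cabs_real gtr0_norm ?invr_gt0//.
by rewrite ler_pdivrMl// mulr1.
Qed.

Lemma of_real_scaleK X (x : X) (r : R) : r != 0 ->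
  of_real r *: (of_real r^-1 *: x) = x.
Proof. by move=> r0; rewrite scalerA -of_realM divff// of_real1 scale1r. Qed.

Lemma lin_bound X Y (T : X -> Y) (C : R) : linear T ->
  (forall x, unit_ball X x -> rnorm (T x) <= C) ->
  forall x, rnorm (T x) <= C * rnorm x.
Proof.
move=> lT TC x; have := rnorm_ge0 x; rewrite le_eqVlt => /predU1P[x0|x0].
  by rewrite (rnorm_eq0 (esym x0)) (lin0 lT) !rnorm0 mulr0.
have := TC _ (unit_ball_scale x0 (lexx _)).
by rewrite (linZ lT) rnormZ cabs_real gtr0_norm ?invr_gt0// ler_pdivrMl// mulrC.
Qed.

Lemma bounded_operatorP X Y (T : X -> Y) : bounded_operator T <->
  linear T /\ exists2 C, 0 < C & forall x, rnorm (T x) <= C * rnorm x.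
Proof.
split=> [[lT cT]|[lT [C C0 TC]]]; split=> //.
  have /cvg_rnorm/(_ 1 ltr01) := cT 0.
  move=> /nbhs_rnorm[e e0 eT].
  have e2 : 0 < e / 2 by rewrite divr_gt0.
  (* A vector of norm at most [e / 2] lies strictly inside the ball of radius [e], which [T] maps
     into the unit ball. *)
  exists (2 / e); first by rewrite divr_gt0.
  apply: lin_bound => // x x1.
  have : rnorm (0 - of_real (e / 2) *: x) < e.
    rewrite sub0r rnormN rnormZ cabs_real gtr0_norm//.
    by rewrite (@le_lt_trans _ _ (e / 2 * 1)) ?ler_pM2l//; lra.
  move=> /eT /=; rewrite (lin0 lT) sub0r rnormN (linZ lT) rnormZ cabs_real
    gtr0_norm//.
  rewrite -ltr_pdivlMl// mulr1 invf_div => /ltW //.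
move=> x; apply/cvg_rnorm => e e0; apply/nbhs_rnorm; exists (e / C).
  by rewrite divr_gt0.
move=> y /=; rewrite -(linB lT) ltr_pdivlMr// mulrC; exact: le_lt_trans.
Qed.

Lemma bounded_comp X Y Z (f : Y -> Z) (g : X -> Y) :
  bounded_operator f -> bounded_operator g -> bounded_operator (f \o g).
Proof.
move=> [lf cf] [lg cg]; split; first exact: linear_comp.
by move=> x; apply: continuous_comp; [exact: cg|exact: cf].
Qed.

Lemma bounded_id X : bounded_operator (@id X).
Proof. by split=> // x. Qed.

Lemma bounded_add X Y (f g : X -> Y) :
  bounded_operator f -> bounded_operator g -> bounded_operator (f \+ g).
Proof.
move=> /bounded_operatorP[lf [C C0 fC]] /bounded_operatorP[lg [D D0 gD]].
apply/bounded_operatorP; split.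
  by move=> a x y /=; rewrite lf lg scalerDr addrACA.
exists (C + D) => [|x /=]; first by rewrite addr_gt0.
by rewrite (le_trans (rnormD _ _))// mulrDl lerD.
Qed.

Lemma bounded_scale X Y (c : K) (f : X -> Y) :
  bounded_operator f -> bounded_operator (fun x => c *: f x).
Proof.
move=> /bounded_operatorP[lf [C C0 fC]]; apply/bounded_operatorP; split.
  by move=> a x y /=; rewrite lf scalerDr !scalerA mulrC.
exists (cabs c * C + 1); first by rewrite ltr_wpDl// mulr_ge0 ?cabs_ge0// ltW.
move=> x; rewrite rnormZ mulrDl -mulrA ler_wpDr ?mulr_ge0 ?rnorm_ge0//.
by rewrite ler_wpM2l// cabs_ge0.
Qed.

Lemma opnorm_le X Y (T : X -> Y) (C : R) :
  (forall x, unit_ball X x -> rnorm (T x) <= C) -> opnorm T <= C.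
Proof.
move=> TC; apply: ge_sup.
  by exists (rnorm (T 0)); exists 0 => //=; rewrite /unit_ball /= rnorm0.
by move=> _ [x x1 <-]; exact: TC.
Qed.

Lemma opnorm_ub X Y (T : X -> Y) (x : X) : bounded_operator T ->
  unit_ball X x -> rnorm (T x) <= opnorm T.
Proof.
move=> /bounded_operatorP[lT [C C0 TC]] x1; apply: ub_le_sup; last by exists x.
exists C => _ [z z1 <-]; rewrite (le_trans (TC _))//.
by rewrite -[leRHS]mulr1 ler_pM2l.
Qed.

Lemma opnorm_ge0 X Y (T : X -> Y) : bounded_operator T -> 0 <= opnorm T.
Proof.
move=> bT; rewrite (le_trans (rnorm_ge0 (T 0)))// opnorm_ub//.
by rewrite /unit_ball /= rnorm0.
Qed.

(** The centres may lie outside [A], so a net of a set serves all its subsets. *)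
Definition totally_bounded X (A : set X) := forall e : R, 0 < e ->
  exists t : seq X, forall x, A x -> exists2 y, y \in t & rnorm (x - y) < e.

Lemma totally_boundedS X (A B : set X) :
  A `<=` B -> totally_bounded B -> totally_bounded A.
Proof. by move=> AB tB e /tB[t ht]; exists t => x /AB; exact: ht. Qed.

Lemma totally_bounded_image2 X Y Z (f : X -> Y -> Z) (C : R) A B : 0 < C ->
  (forall x x' y y', rnorm (f x y - f x' y') <=
    C * (rnorm (x - x') + rnorm (y - y'))) ->
  totally_bounded A -> totally_bounded B ->
  totally_bounded [set f a b | a in A & b in B].
Proof.
move=> C0 fC tA tB e e0.
have d0 : 0 < e / C / 2 by rewrite !divr_gt0.
have [ta hA] := tA _ d0; have [tb hB] := tB _ d0.
exists [seq f a b | a <- ta, b <- tb] =>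
  _ [a /hA[a' a't aa'] [b /hB[b' b't bb'] <-]].
exists (f a' b'); first exact: allpairs_f.
rewrite (le_lt_trans (fC _ _ _ _))// mulrC -ltr_pdivlMr//.
by rewrite (splitr (e / C)) ltrD.
Qed.

Lemma totally_bounded_image X Y (f : X -> Y) A : bounded_operator f ->
  totally_bounded A -> totally_bounded (f @` A).
Proof.
move=> /bounded_operatorP[lf [C C0 fC]] tA e e0.
have [t ht] := tA _ (divr_gt0 e0 C0).
exists (map f t) => _ [x /ht[y yt xy] <-]; exists (f y); first exact: map_f.
by rewrite -(linB lf) (le_lt_trans (fC _))// mulrC -ltr_pdivlMr.
Qed.

Lemma totally_bounded_bounded X (A : set X) : totally_bounded A ->
  exists2 C : R, 0 < C & forall x, A x -> rnorm x <= C.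
Proof.
move=> /(_ 1 ltr01)[t ht]; exists (1 + \sum_(y <- t) rnorm y).
  by rewrite ltr_pwDl// sumr_ge0// => y _; exact: rnorm_ge0.
move=> x /ht[y yt xy]; rewrite -(subrK y x) (le_trans (rnormD _ _))//.
rewrite lerD ?(ltW xy)// (big_rem y)//= lerDl sumr_ge0// => z _.
exact: rnorm_ge0.
Qed.

Lemma ultra_seq_cover (I : eqType) (T : Type) (F : set_system T)
  (FU : UltraFilter F) (t : seq I) (B : I -> set T) :
  F [set x | exists2 i, i \in t & B i x] -> exists i, F (B i).
Proof.
elim: t => [|i t IHt] Ft.
  exfalso; apply: (@filter_not_empty _ F); apply: filterS Ft => x [j].
  by rewrite in_nil.
have [FB|FB] := in_ultra_setVsetC (B i) FU; first by exists i.
apply: IHt; apply: filterS (filterI Ft FB) => x [[j]].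
by rewrite in_cons => /predU1P[->//|jt Bj] _; exists j.
Qed.

(** An ultrafilter on the closure contains, for each radius, one of the finitely many balls of a
    net. Hence it is Cauchy and converges, and its limit is again in the closure. *)
Lemma totally_bounded_compact X (A : set X) :
  totally_bounded A -> compact (closure A).
Proof.
move=> tA; rewrite compact_ultra => F FU FA.
have [|x Fx] := banach_complete (F := F).
  move=> e e0; have [t ht] := tA _ (divr2_gt0 e0).
  apply: (@ultra_seq_cover _ _ F FU t (fun x => [set y | rnorm (x - y) < e])).
  apply: filterS FA => x /closure_rnorm/(_ _ (divr2_gt0 e0))[y Ay xy].
  have [z zt yz] := ht _ Ay; exists z => //=.
  rewrite (le_lt_trans (rdist_triangle y _ _))// (splitr e) ltrD//.
    by rewrite rdistC.
  by rewrite rdistC.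
exists x; split; last exact/cvg_rnorm.
apply/closure_rnorm => e e0.
have e2 : 0 < e / 2 by rewrite divr_gt0.
have [y [/= xy /closure_rnorm/(_ _ e2)[z Az yz]]] :=
  filter_ex (filterI (Fx _ e2) FA).
exists z => //; rewrite (le_lt_trans (rdist_triangle y _ _))//.
by rewrite (splitr e) ltrD.
Qed.

Lemma compact_totally_bounded X (A : set X) : compact A -> totally_bounded A.
Proof.
rewrite compact_cover => cA e e0.
pose B (x : X) := interior [set y | rnorm (x - y) < e].
have [||D _ AD] := cA X setT B.
- by move=> x _; exact: open_interior.
- move=> x Ax; exists x => //; apply/nbhs_rnorm; exists e => // y.
exists (finmap.enum_fset D) => x /AD[y yD /interior_subset/= xy].
by exists y => //; rewrite rdistC.
Qed.

Lemma compact_operatorP X Y (T : X -> Y) : compact_operator T <->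
  linear T /\ totally_bounded (T @` unit_ball X).
Proof.
split=> -[lT cT]; split=> //; last exact: totally_bounded_compact.
by apply: totally_boundedS (compact_totally_bounded cT); exact: subset_closure.
Qed.

Lemma compact_operator_bounded X Y (T : X -> Y) : compact_operator T ->
  bounded_operator T.
Proof.
move=> /compact_operatorP[lT /totally_bounded_bounded[C C0 TC]].
apply/bounded_operatorP; split=> //; exists C => //.
by apply: lin_bound => // x x1; apply: TC; exists x.
Qed.

Lemma compact_comp_right X Y Z (f : Y -> Z) (g : X -> Y) :
  compact_operator f -> linear g ->
  (forall x, unit_ball X x -> unit_ball Y (g x)) -> compact_operator (f \o g).
Proof.
move=> /compact_operatorP[lf tf] lg g1; apply/compact_operatorP.
split; first exact: linear_comp.
by apply: totally_boundedS tf => _ [x /g1 gx1 <-]; exists (g x).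
Qed.

Lemma compact_comp_left X Y Z (f : Y -> Z) (g : X -> Y) :
  bounded_operator f -> compact_operator g -> compact_operator (f \o g).
Proof.
move=> bf /compact_operatorP[lg tg]; apply/compact_operatorP.
split; first exact: linear_comp bf.1 lg.
by rewrite -(image_comp g f); exact: totally_bounded_image.
Qed.

End BoundedOperators.

(** * Total boundedness of balls of scalars *)

Lemma real_interval_net (R : realType) (M e : R) : 0 < e ->
  exists t : seq R, forall x, `|x| <= M -> exists2 y, y \in t & `|x - y| < e.
Proof.
move=> e0.
have := @compact_totally_bounded R RealScalars R^o _ (@segment_compact R (- M)
  M) _ e0.
by move=> [t ht]; exists t => x; rewrite ler_norml => xM; apply: ht;
  rewrite /= in_itv.
Qed.

Lemma scalar_ball_totally_bounded (R : realType) (s : scalars) (M : R) :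
  totally_bounded [set x : scalar_space R s | rnorm x <= M].
Proof.
move=> e e0; case: s => [|].
  by have [t ht] := real_interval_net M e0; exists t => x; exact: ht.
have [t ht] := real_interval_net M (divr2_gt0 e0).
exists [seq (a +i* b)%C | a <- t, b <- t] => -[a b]; rewrite /rnorm /= => abM.
have [|a' a't aa'] := ht a.
  apply: le_trans abM; rewrite -sqrtr_sqr ler_sqrt ?lerDl ?sqr_ge0//.
  by rewrite addr_ge0 ?sqr_ge0.
have [|b' b't bb'] := ht b.
  apply: le_trans abM; rewrite -sqrtr_sqr ler_sqrt ?lerDr ?sqr_ge0//.
  by rewrite addr_ge0 ?sqr_ge0.
exists (a' +i* b')%C; first exact: allpairs_f.
rewrite (le_lt_trans (y := `|a - a'| + `|b - b'|))//; last first.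
  by rewrite (splitr e) ltrD.
rewrite -[leRHS]ger0_norm ?addr_ge0// -sqrtr_sqr /= ler_sqrt ?sqr_ge0//.
rewrite [leRHS]sqrrD !real_normK ?num_real// [leRHS]addrAC lerDl.
by rewrite mulrn_wge0// mulr_ge0.
Qed.

(** * The product of two Banach spaces *)

Section ProductSpace.
Context {R : realType} {s : scalars}.
Variables X Y : banach R s.

(** This is the middle space for a sum of two factorizations. With the maximum norm, pairing two
    maps that preserve unit balls gives another such map. *)
Lemma product_banach : exists (P : banach R s) (p : X -> Y -> P)
    (p1 : P -> X) (p2 : P -> Y),
  [/\ bounded_operator p1 /\ bounded_operator p2,
      forall z, rnorm (p1 z) <= rnorm z /\ rnorm (p2 z) <= rnorm z,
      forall x y, p1 (p x y) = x /\ p2 (p x y) = y,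
      forall a x x' y y', p (a *: x + x') (a *: y + y') = a *: p x y + p x' y' &
      forall x y, rnorm (p x y) = Num.max (rnorm x) (rnorm y)].
Proof.
pose N (v : X * Y) := Num.max (rnorm v.1) (rnorm v.2).
have [||||P [j [k [lj jk kj jN]]]] := @banach_of_norm R s (X * Y)%type N.
- move=> x y; rewrite /N ge_max !(le_trans (rnormD _ _))// lerD// le_max lexx//.
    by rewrite orbT.
  by rewrite orbT.
- by move=> c x; rewrite /N /= !rnormZ maxr_pMr// cabs_ge0.
- move=> [x y] /eqP; rewrite /N /= eq_le ge_max => /andP[/andP[x0 y0] _].
  congr (_, _).
    by apply: rnorm_eq0; apply/eqP; rewrite eq_le x0 rnorm_ge0.
  by apply: rnorm_eq0; apply/eqP; rewrite eq_le y0 rnorm_ge0.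
- move=> F FF Fc.
  have [|x Fx] := banach_complete (F := fst @ F).
    move=> e /Fc[x Fx]; exists x.1; rewrite nbhs_simpl /=.
    by apply: filterS Fx => y /=; rewrite /N gt_max => /andP[].
  have [|y Fy] := banach_complete (F := snd @ F).
    move=> e /Fc[y Fy]; exists y.2; rewrite nbhs_simpl /=.
    by apply: filterS Fy => z /=; rewrite /N gt_max => /andP[].
  exists (x, y) => e e0; have := Fx _ e0; have := Fy _ e0.
  rewrite !nbhs_simpl /= => Fye Fxe.
  apply: filterS (filterI Fxe Fye) => z /= [].
  by rewrite /N /= gt_max => -> ->.
have lk : linear k by move=> a u v; apply: (can_inj jk); rewrite kj lj !kj.
have kN z : rnorm (k z).1 <= rnorm z /\ rnorm (k z).2 <= rnorm z.
  by rewrite -[z in leRHS]kj -[z in X in _ /\ _ <= X]kj jN /N !le_max !lexx orbT.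
exists P, (fun x y => j (x, y)), (fun z => (k z).1), (fun z => (k z).2); split.
- split; apply/bounded_operatorP; split; try by move=> a u v; rewrite lk.
    by exists 1 => // z; rewrite mul1r; case: (kN z).
  by exists 1 => // z; rewrite mul1r; case: (kN z).
- exact: kN.
- by move=> x y; rewrite jk.
- by move=> a x x' y y'; rewrite -lj.
- by move=> x y; rewrite jN.
Qed.

End ProductSpace.

(** * Factorizations through a compact operator, and sums of them *)

Section Ideal.
Context {R : realType} {s : scalars} (A : quasi_normed_ideal R s).
Implicit Types X Y Z : banach R s.

Lemma opnorm_id_le X : opnorm (@id X) <= 1.
Proof. exact: opnorm_le. Qed.

Lemma ideal_comp_left X Y Z (U : Y -> Z) (S : X -> Y) :
  bounded_operator U -> ideal_mem A S ->
  ideal_mem A (U \o S) /\ ideal_qnorm A (U \o S) <= opnorm U * ideal_qnorm A S.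
Proof.
move=> bU AS; split; first exact: (ideal_comp (bounded_id X) AS bU).
rewrite (le_trans (ideal_qnorm_comp (bounded_id X) AS bU))// -[leRHS]mulr1.
rewrite ler_wpM2l ?opnorm_id_le// mulr_ge0 ?opnorm_ge0//.
exact: ideal_qnorm_ge0.
Qed.

Lemma ideal_comp_right X Y Z (U : Y -> Z) (S : X -> Y) :
  bounded_operator S -> ideal_mem A U ->
  ideal_mem A (U \o S) /\ ideal_qnorm A (U \o S) <= ideal_qnorm A U * opnorm S.
Proof.
move=> bS AU; split; first exact: (ideal_comp bS AU (bounded_id Z)).
rewrite (le_trans (ideal_qnorm_comp bS AU (bounded_id Z)))//
  ler_wpM2r ?opnorm_ge0//.
by rewrite -[leRHS]mul1r ler_wpM2r ?opnorm_id_le ?ideal_qnorm_ge0.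
Qed.

(** A factorization rescaled so that the whole norm sits in the ideal factor. Sums and
    precompositions then need no bookkeeping of the norm of the compact factor. *)
Definition normalized_factor X Y (T : X -> Y) (e : R) := exists Z (U : Z -> Y) V,
  [/\ factorization A T U V, forall x, unit_ball X x -> unit_ball Z (V x) &
      ideal_qnorm A U <= e].

Lemma normalized_factor_alpha X Y (T : X -> Y) e :
  normalized_factor T e -> (alpha_kappa A T <= e%:E)%E.
Proof.
move=> [Z [U [V [[AU cV TE] V1 Ue]]]].
apply: ge_ereal_inf; exists (ideal_qnorm A U * opnorm V)%:E.
  by exists Z, U, V.
rewrite lee_fin (le_trans _ Ue)// -[leRHS]mulr1 ler_wpM2l ?ideal_qnorm_ge0//.
exact: opnorm_le.
Qed.

Lemma alpha_normalized_factor X Y (T : X -> Y) e :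
  (alpha_kappa A T < e%:E)%E -> normalized_factor T e.
Proof.
move=> /ereal_inf_lt[_ [Z [U [V [[AU cV TE] ->]]]]]; rewrite lte_fin => UVe.
have bV := compact_operator_bounded cV.
have U0 := ideal_qnorm_ge0 AU; have V0 := opnorm_ge0 bV.
set u := ideal_qnorm A U in UVe U0 *; set v := opnorm V in UVe V0 *.
(* The scaling constant is strictly above [v], hence positive even if [V = 0], and so little above
   it that [u * c <= e]. The denominator [u + 1] covers [u = 0]. *)
pose c := v + (e - u * v) / (u + 1).
have u1 : 0 < u + 1 by rewrite ltr_wpDl.
have d0 : 0 < (e - u * v) / (u + 1) by rewrite divr_gt0// subr_gt0.
have c0 : 0 < c by rewrite /c ltr_wpDl.
have uc : u * c <= e.
  have dE : (e - u * v) / (u + 1) * (u + 1) = e - u * v by rewrite divfK ?gt_eqF.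
  by move: d0 dE; rewrite /c; set d := _ / _ => d0 dE; lra.
have bc (W : banach R s) (r : R) : bounded_operator (fun w : W => of_real r *: w).
  exact: bounded_scale (bounded_id W).
have [AUc Uc] := ideal_comp_right (bc Z c) AU.
exists Z, (U \o (fun w => of_real c *: w)), (fun x => of_real c^-1 *: V x); split.
- split=> //; first exact: (compact_comp_left (bc Z c^-1) cV).
  by rewrite TE; apply/funext => x /=; rewrite of_real_scaleK// gt_eqF.
- move=> x x1; apply: unit_ball_scale => //.
  by rewrite (le_trans (opnorm_ub bV x1))// /c lerDl ltW.
- rewrite (le_trans Uc)// (le_trans _ uc)// ler_wpM2l//.
  apply: opnorm_le => x x1; rewrite rnormZ cabs_real gtr0_norm//.
  by rewrite -[leRHS]mulr1 ler_wpM2l// ltW.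
Qed.

Lemma normalized_factor_comp X Y Z (T : Y -> Z) (S : X -> Y) e :
  linear S -> (forall x, unit_ball X x -> unit_ball Y (S x)) ->
  normalized_factor T e -> normalized_factor (T \o S) e.
Proof.
move=> lS S1 [W [U [V [[AU cV ->] V1 Ue]]]]; exists W, U, (V \o S); split=> //.
  by split=> //; exact: compact_comp_right.
by move=> x /S1 /V1.
Qed.

Lemma unit_ballN X (x : X) : unit_ball X x -> unit_ball X (- x).
Proof. by rewrite /unit_ball /= rnormN. Qed.

Lemma linear_opp X Y (f : X -> Y) : linear f -> linear (fun x => - f x).
Proof. by move=> lf a x y; rewrite lf opprD scalerN. Qed.

Lemma normalized_factorN X Y (T : X -> Y) e : linear T ->
  normalized_factor T e -> normalized_factor (fun x => - T x) e.
Proof.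
move=> lT hT; rewrite (_ : (fun x => - T x) = T \o (fun x => - x)).
  apply: normalized_factor_comp hT; last exact: unit_ballN.
  exact: linear_opp.
by apply/funext => x /=; rewrite (linN lT).
Qed.

(** The compact factors are paired into the product space and the ideal factors are precomposed with
    the projections, which have norm at most one. The constant [k] is that of the quasi-triangle
    inequality. *)
Lemma normalized_factorD : exists2 k : R, 1 <= k &
  forall X Y (S T : X -> Y) a b, normalized_factor S a -> normalized_factor T b ->
    normalized_factor (S \+ T) (k * (a + b)).
Proof.
have [k k1 kA] := ideal_qnorm_add A; exists k => // X Y S T a b.
move=> [W [U [V [[AU cV ->] V1 Ua]]]] [W' [U' [V' [[AU' cV' ->] V1' Ub]]]].
have [P [p [p1 [p2 [[bp1 bp2] pN pK lp Np]]]]] := product_banach W W'.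
have [AUp Up] := ideal_comp_right bp1 AU.
have [AUp' Up'] := ideal_comp_right bp2 AU'.
exists P, ((U \o p1) \+ (U' \o p2)), (fun x => p (V x) (V' x)); split.
- split; first exact: ideal_add.
    have [lV tV] := (compact_operatorP V).1 cV.
    have [lV' tV'] := (compact_operatorP V').1 cV'.
    apply/compact_operatorP; split; first by move=> c x y; rewrite lV lV' lp.
    apply: totally_boundedS
      (totally_bounded_image2 (f := p) (C := 1) _ _ tV tV') => //.
      move=> _ [x x1 <-]; exists (V x); first by exists x.
      by exists (V' x) => //; exists x.
    move=> x x' y y'; rewrite mul1r.
    have -> : p x y - p x' y' = p (x - x') (y - y').
      have := lp (-1) x' x y' y; rewrite !scaleN1r ![- _ + _]addrC => ->.
      by [].
    by rewrite Np ge_max lerDl lerDr !rnorm_ge0.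
  by apply/funext => x /=; have [-> ->] := pK (V x) (V' x).
- by move=> x x1; rewrite /unit_ball /= Np ge_max; apply/andP; split;
    [exact: V1|exact: V1'].
- rewrite (le_trans (kA _ _ _ _ AUp AUp'))// ler_wpM2l ?(le_trans _ k1)//.
  have h (Q : banach R s) (q : P -> Q) (u c : R) : 0 <= u -> u <= c ->
      (forall z, rnorm (q z) <= rnorm z) -> u * opnorm q <= c.
    move=> u0 uc qN; rewrite (le_trans _ uc)// -[leRHS]mulr1 ler_wpM2l//.
    by apply: opnorm_le => z z1; rewrite (le_trans (qN z)).
  apply: lerD; [apply: le_trans Up _|apply: le_trans Up' _].
    by apply: h => [|//|z]; [exact: ideal_qnorm_ge0|case: (pN z)].
  by apply: h => [|//|z]; [exact: ideal_qnorm_ge0|case: (pN z)].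
Qed.

End Ideal.

(** * Finite-dimensional spans and finite rank operators *)

Section FiniteRank.
Context {R : realType} {s : scalars}.
Local Notation K := (scalar_field R s).
Implicit Types X Y Z : banach R s.

Definition in_span X n (y : 'I_n -> X) (x : X) :=
  exists c : 'I_n -> K, x = \sum_(i < n) c i *: y i.

Lemma in_span_lin X n (y : 'I_n -> X) a u v :
  in_span y u -> in_span y v -> in_span y (a *: u + v).
Proof.
move=> [c ->] [d ->]; exists (fun i => a * c i + d i).
rewrite scaler_sumr -big_split /=; apply: eq_bigr => i _.
by rewrite scalerDl scalerA.
Qed.

Lemma in_span0 X n (y : 'I_n -> X) : in_span y 0.
Proof. by exists (fun=> 0); rewrite big1// => i _; rewrite scale0r. Qed.

Lemma in_spanZ X n (y : 'I_n -> X) a u : in_span y u -> in_span y (a *: u).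
Proof. by move=> yu; rewrite -[_ *: _]addr0; apply: in_span_lin => //;
  exact: in_span0. Qed.

Lemma in_spanD X n (y : 'I_n -> X) u v :
  in_span y u -> in_span y v -> in_span y (u + v).
Proof. by move=> yu yv; rewrite -[u]scale1r; exact: in_span_lin. Qed.

Lemma in_span_recr X n (y : 'I_n.+1 -> X) (x : X) : in_span y x <->
  exists c : K, in_span (fun i =>
    y (widen_ord (leqnSn n) i)) (x - c *: y ord_max).
Proof.
split=> [[c ->]|[c [d]]].
  exists (c ord_max), (fun i => c (widen_ord (leqnSn n) i)).
  by rewrite big_ord_recr /= addrK.
move=> /(canRL (subrK _)) ->.
exists (fun i => if unlift ord_max i is Some j then d j else c).
rewrite big_ord_recr /= unlift_none; congr (_ + _); apply: eq_bigr => i _.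
suff -> : widen_ord (leqnSn n) i = lift ord_max i by rewrite liftK.
by apply: val_inj; rewrite /= /bump leqNgt ltn_ord.
Qed.

(** The span of [y] is closed, so [y0] has a positive distance [d] from it; dividing by [c] gives
    the bound. Closedness is a hypothesis because the lemma serves inside the induction that proves
    it. *)
Lemma coefficient_bound X n (y : 'I_n -> X) (y0 : X) :
  (forall x, (forall e : R, 0 < e -> exists2 w,
    in_span y w & rnorm (x - w) < e) ->
    in_span y x) ->
  ~ in_span y y0 ->
  exists2 d : R, 0 < d & forall w c, in_span y w ->
    d * cabs c <= rnorm (w + c *: y0).
Proof.
move=> cl ny0.
have [d d0 hd] : exists2 d : R, 0 < d & forall w,
  in_span y w -> d <= rnorm (y0 - w).
  apply: contrapT => nd; apply/ny0/cl => e e0; apply: contrapT => nw; apply: nd.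
  exists e => // w yw; rewrite leNgt; apply/negP => h; apply: nw.
  by exists w.
exists d => // w c yw; have [->|c0] := eqVneq c 0.
  by rewrite /cabs normr0 -(of_real0 (R := R) (s :=
    s)) real_partK mulr0 rnorm_ge0.
rewrite (_ : w + c *: y0 = c *: (y0 - (- c^-1) *: w)); last first.
  by rewrite scalerBr scalerA mulrN divff// scaleN1r opprK addrC.
by rewrite rnormZ mulrC ler_wpM2l ?cabs_ge0// hd//; exact: in_spanZ.
Qed.

(** Induction on [n]. If the last vector [y0] is outside the span of the others, the bound on its
    coefficient makes the coefficients of approximations to [x] Cauchy. With [c] their limit, the
    induction hypothesis applies to [x - c *: y0]. *)
Lemma span_closed X n (y : 'I_n -> X) x :
  (forall e : R, 0 < e -> exists2 w, in_span y w & rnorm (x - w) < e) ->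
  in_span y x.
Proof.
elim: n y x => [|n IHn] y x hx.
  suff -> : x = 0 by exact: in_span0.
  apply: rnorm_eq0; apply/eqP; rewrite eq_le rnorm_ge0 andbT.
  apply/ler_addgt0Pr => e e0; rewrite add0r.
  by have [_ [c ->]] := hx _ e0; rewrite big_ord0 subr0 => /ltW.
pose y' i := y (widen_ord (leqnSn n) i); pose y0 := y ord_max.
apply/in_span_recr; rewrite -/y' -/y0.
have [yy0|ny0] := pselect (in_span y' y0).
  exists 0; rewrite scale0r subr0; apply: IHn => e /hx[w].
  move=> /in_span_recr[c wc] xw; exists w => //.
  rewrite -(subrK (c *: y0) w); apply: in_spanD => //; exact: in_spanZ.
have [d d0 hd] := coefficient_bound (@IHn y') ny0.
(* The coefficients of [y0] in the approximations of [x] up to [e]; these sets form a filter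
   base. *)
pose B (e : R) : set (scalar_space R s) :=
  [set c | exists2 w, in_span y' w & rnorm (x - (w + sc_val c *: y0)) < e].
have Fproper : ProperFilter (filter_from [set e : R | 0 < e] B).
  apply: filter_from_proper => [|e /= /hx[w /in_span_recr[c wc] xw]].
    apply: filter_from_filter; first by exists 1; rewrite /= ltr01.
    move=> e f /= e0 f0; exists (Num.min e f); first by rewrite lt_min e0.
    by move=> c [w yw]; rewrite lt_min => /andP[we wf]; split; exists w.
  exists (sc_of c); exists (w - c *: y0) => //.
  by rewrite sc_ofK subrK.
have FB e : 0 < e -> filter_from [set e : R | 0 < e] B (B e) by move=> e0;
  exists e.
have [|c Fc] := banach_complete (F := filter_from [set e : R | 0 < e] B).
  (* Two approximations up to [d * e / 2] are less than [d * e] apart, so their coefficients differ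
     by less than [e]. *)
  move=> e e0; have e2 : 0 < d * e / 2 by rewrite divr_gt0// mulr_gt0.
  have [c [w yw xw]] := filter_ex (FB _ e2).
  exists c; exists (d * e / 2) => // c' [w' yw' xw'] /=.
  rewrite -(ltr_pM2l d0) -cabs_sc_val sc_valB.
  rewrite (le_lt_trans (hd (w - w') _ _))//.
    by rewrite addrC -scaleN1r; exact: in_span_lin.
  rewrite scalerBl addrACA -opprD.
  rewrite (le_lt_trans (rdist_triangle x _ _))// [ltRHS]splitr ltrD//.
  by rewrite rdistC.
exists (sc_val c); apply: IHn => e e0.
pose e1 := e / 2 / (rnorm y0 + 1).
have y1 : 0 < rnorm y0 + 1 by rewrite ltr_wpDl// rnorm_ge0.
have e10 : 0 < e1 by rewrite !divr_gt0.
have e2 := divr2_gt0 e0.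
have [c' [/= cc' [w yw xw]]] := filter_ex (filterI (Fc _ e10) (FB _ e2)).
exists w => //.
rewrite (_ : _ - w = (x - (w + sc_val c' *: y0)) - (sc_val (c - c') *: y0));
  last first.
  by rewrite sc_valB scalerBl opprB addrA opprD !addrA subrK addrAC.
rewrite (le_lt_trans (rnormB _ _))// (splitr e) ltr_leD//.
rewrite rnormZ cabs_sc_val (@le_trans _ _ (e1 * rnorm y0))//.
  by rewrite ler_wpM2r ?rnorm_ge0// ltW.
rewrite /e1 -mulrA -[leRHS]mulr1 ler_wpM2l ?(ltW e2)//.
by rewrite ler_pdivrMl// mulr1 lerDl.
Qed.

Lemma rank_one_bounded X Y (g : X -> scalar_space R s) (y : Y) :
  dual X g -> bounded_operator (fun x => sc_val (g x) *: y).
Proof.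
move=> /bounded_operatorP[lg [C C0 gC]]; apply/bounded_operatorP; split.
  by move=> a u v; rewrite lg sc_val_linear scalerDl scalerA.
exists (C * (rnorm y + 1)) => [|x];
  first by rewrite mulr_gt0// ltr_wpDl ?rnorm_ge0.
rewrite rnormZ cabs_sc_val (le_trans (ler_wpM2r (rnorm_ge0 _) (gC x)))//.
by rewrite mulrAC ler_wpM2r ?rnorm_ge0// ler_pM2l// lerDl.
Qed.

(** An operator of finite rank is a finite sum of rank one operators. If [y0] is outside the span of
    the other vectors, its coefficient in [T x] is unique, hence linear in [x], and bounded by
    [coefficient_bound]; subtracting that rank one operator removes [y0]. *)
Lemma finite_rank_ind X Y (P : (X -> Y) -> Prop) :
  P (fun=> 0) ->
  (forall g y, dual X g -> P (fun x => sc_val (g x) *: y)) ->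
  (forall S T, P S -> P T -> P (S \+ T)) ->
  forall T, finite_rank X Y T -> P T.
Proof.
move=> P0 P1 PD T [bT [n [y Ty]]].
elim: n y T bT Ty => [|n IHn] y T bT Ty.
  rewrite (_ : T = fun=> 0)//; apply/funext => x.
  by have [c ->] := Ty x; rewrite big_ord0.
pose y' i := y (widen_ord (leqnSn n) i); pose y0 := y ord_max.
have {}Ty x : in_span y (T x) by exact: Ty.
have [yy0|ny0] := pselect (in_span y' y0).
  apply: (IHn y') => // x; have /in_span_recr[c Tc] := Ty x.
  rewrite -/(in_span y' (T x)) -(subrK (c *: y0) (T x)).
  by apply: in_spanD => //; exact: in_spanZ.
have [d d0 hd] := coefficient_bound (@span_closed _ _ y') ny0.
have /choice[g hg] x : exists c : K, in_span y' (T x - c *: y0).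
  by have /in_span_recr[c Tc] := Ty x; exists c.
have uniq c w : in_span y' w -> w = c *: y0 -> c = 0.
  move=> yw wc; have := hd w (- c) yw; rewrite wc scaleNr subrr rnorm0.
  rewrite pmulr_rle0// => c0; apply/eqP; rewrite -normr_eq0 -normrN -of_real_cabs.
  by rewrite (_ : cabs (- c) = 0) ?of_real0//; apply/eqP;
    rewrite eq_le c0 cabs_ge0.
have addKrB (p q r : Y) : p - q + (r - p) = r - q.
  by rewrite [LHS]addrC addrA subrK.
have lg a u v : g (a *: u + v) = a * g u + g v.
  apply/eqP; rewrite -subr_eq0; apply/eqP.
  (* This combination of remainders lies in the span of [y'] and equals the additivity defect of [g]
     times [y0], so the defect vanishes. *)
  apply: (uniq _ ((a *: (T u - g u *: y0) + (T v - g v *: y0)) +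
    (-1) *: (T (a *: u + v) - g (a *: u + v) *: y0))).
    by apply: in_spanD; [exact: in_span_lin|exact: in_spanZ].
  rewrite bT.1 scaleN1r scalerBr scalerA addrACA -opprD -scalerDl opprB.
  by rewrite scalerBl; exact: addKrB.
have bg : dual X (fun x => sc_of (g x)).
  apply/bounded_operatorP; split.
    by move=> a u v; apply: (can_inj sc_valK); rewrite sc_val_linear !sc_ofK lg.
  have [_ [C C0 TC]] := (bounded_operatorP T).1 bT.
  exists (C / d) => [|x]; first by rewrite divr_gt0.
  rewrite -cabs_sc_val sc_ofK mulrAC ler_pdivlMr// mulrC.
  by rewrite (le_trans (hd _ (g x) (hg x)))// subrK.
have gE : (fun x => g x *: y0) = (fun x => sc_val (sc_of (g x)) *: y0).
  by apply/funext => x; rewrite sc_ofK.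
rewrite (_ : T = (fun x => T x + (-1) *: (g x *: y0)) \+ (fun x => g x *: y0));
  last first.
  by apply/funext => x /=; rewrite scaleN1r subrK.
have bgy : bounded_operator (fun x => g x *: y0) by rewrite gE;
  exact: rank_one_bounded.
apply: PD; last by rewrite gE; exact: P1.
apply: (IHn y') => [|x]; last by rewrite scaleN1r; exact: hg.
by apply: bounded_add => //; exact: bounded_scale.
Qed.

Lemma finite_rank0 X Y : finite_rank X Y (fun=> 0).
Proof.
split; last by exists 0%N, (fun=> 0) => x; exists (fun=> 0); rewrite big_ord0.
apply/bounded_operatorP; split; first by move=> a x y; rewrite scaler0 addr0.
by exists 1 => // x; rewrite rnorm0 mul1r rnorm_ge0.
Qed.

Lemma finite_rankD X Y (S T : X -> Y) :
  finite_rank X Y S -> finite_rank X Y T -> finite_rank X Y (S \+ T).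
Proof.
move=> [bS [m [y Sy]]] [bT [n [z Tz]]]; split; first exact: bounded_add.
pose cat (V : Type) (a : 'I_m -> V) (b : 'I_n -> V) (i : 'I_(m + n)) :=
  match fintype.split i with inl j => a j | inr j => b j end.
exists (m + n)%N, (cat _ y z) => x.
have [c Sc] := Sy x; have [d Td] := Tz x; exists (cat _ c d).
rewrite /= Sc Td big_split_ord /=; congr (_ + _); apply: eq_bigr => i _.
  by rewrite /cat -[lshift _ _]/(unsplit (inl _)) unsplitK.
by rewrite /cat -[rshift _ _]/(unsplit (inr _)) unsplitK.
Qed.

Lemma finite_rank_one X Y (g : X -> scalar_space R s) (y : Y) :
  dual X g -> finite_rank X Y (fun x => sc_val (g x) *: y).
Proof.
move=> dg; split; first exact: rank_one_bounded.
by exists 1%N, (fun=> y) => x; exists (fun=> sc_val (g x)); rewrite big_ord1.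
Qed.

Lemma finite_rank_comp X Y Z (S : Y -> Z) (T : X -> Y) :
  finite_rank Y Z S -> bounded_operator T -> finite_rank X Z (S \o T).
Proof.
move=> [bS [n [y Sy]]] bT; split; first exact: bounded_comp.
by exists n, y => x; exact: Sy.
Qed.

End FiniteRank.

(** * The Hahn-Banach theorem for seminorms, real and complex *)

Section HahnBanach.
Context {R : realType} {s : scalars}.
Local Notation K := (scalar_field R s).
Variables (V : lmodType K) (q : V -> R).
Hypothesis qD : forall x y, q (x + y) <= q x + q y.
Hypothesis qZ : forall (c : K) x, q (c *: x) = cabs c * q x.

Let qZ_real (r : R) x : 0 <= r -> q (of_real r *: x) = r * q x.
Proof. by move=> r0; rewrite qZ cabs_real ger0_norm. Qed.

(** Partial real linear functionals as graphs, so that chains have plain unions. Single-valuedness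
    follows from domination: two values at one vector give their difference, in both signs, at [0],
    where [q] vanishes. *)
Definition dominated_graph (G : set (V * R)) :=
  (forall (r : R) p p', G p -> G p' ->
     G (of_real r *: p.1 + p'.1, r * p.2 + p'.2)) /\
  (forall p, G p -> p.2 <= q p.1).

(** The value at [v0] must lie above all [p.2 - q (p.1 - v0)] and below all [q (p.1 + v0) - p.2].
    Subadditivity separates the two families, and the supremum of the first is taken. Division by
    the modulus of [r] reduces domination to these two bounds. *)
Lemma dominated_graph_extend (G : set (V * R)) (v0 : V) :
  dominated_graph G -> G (0, 0) ->
  exists t : R, dominated_graph
    [set p | exists r p', G p' /\ p = (p'.1 + of_real r *: v0, p'.2 + r * t)].
Proof.
move=> [lG dG] G0.
have gap p p' : G p -> G p' -> p'.2 - q (p'.1 - v0) <= q (p.1 + v0) - p.2.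
  move=> Gp Gp'; have /dG /= := lG 1 _ _ Gp Gp'.
  rewrite of_real1 scale1r mul1r => h.
  have := qD (p.1 + v0) (p'.1 - v0); rewrite addrACA subrr addr0.
  by move: h; lra.
pose S := [set p.2 - q (p.1 - v0) | p in G].
have St p : G p -> p.2 - q (p.1 - v0) <= sup S.
  move=> Gp; apply: ub_le_sup; last by exists p.
  by exists (q (p.1 + v0) - p.2) => _ [p' Gp' <-]; exact: gap.
have tS p : G p -> sup S <= q (p.1 + v0) - p.2.
  move=> Gp; apply: ge_sup; first by exists (0 - q (0 - v0)); exists (0, 0).
  by move=> _ [p' Gp' <-]; exact: gap.
exists (sup S); split.
  move=> r _ _ [a [p [Gp ->]]] [b [p' [Gp' ->]]] /=.
  exists (r * a + b), (of_real r *: p.1 + p'.1, r * p.2 + p'.2).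
  split; first exact: lG.
  congr (_, _) => /=; last by ring.
  by rewrite scalerDr scalerA -of_realM addrACA -scalerDl -of_realD.
have scaleG r p : G p -> G (of_real r *: p.1, r * p.2).
  by move=> Gp; have := lG r _ _ Gp G0; rewrite /= !addr0.
move=> _ [r [p [Gp ->]]] /=; have [r0|r0|->] := ltrgtP r 0.
- have nr0 : 0 < - r by rewrite oppr_gt0.
  have /St /= := scaleG (- r)^-1 _ Gp.
  have -> : of_real (- r)^-1 *: p.1 - v0 =
      of_real (- r)^-1 *: (p.1 + of_real r *: v0).
    rewrite scalerDr scalerA -of_realM (_ : (- r)^-1 * r = -1).
      by rewrite of_realN of_real1 scaleN1r.
    by rewrite invrN mulNr mulVf// lt_eqF.
  rewrite qZ_real ?invr_ge0 ?(ltW nr0)// -mulrBr ler_pdivrMl//; lra.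
- have /tS /= := scaleG r^-1 _ Gp.
  have -> : of_real r^-1 *: p.1 + v0 = of_real r^-1 *: (p.1 + of_real r *: v0).
    by rewrite scalerDr scalerA -of_realM mulVf ?gt_eqF// of_real1 scale1r.
  rewrite qZ_real ?invr_ge0 ?(ltW r0)// -mulrBr ler_pdivlMl//; lra.
- by rewrite of_real0 scale0r mul0r !addr0; exact: dG.
Qed.

Lemma real_hahn_banach (G0 : set (V * R)) :
  dominated_graph G0 -> G0 (0, 0) -> exists H : V -> R,
    [/\ forall (r : R) u v, H (of_real r *: u + v) = r * H u + H v,
        forall p, G0 p -> H p.1 = p.2 & forall v, H v <= q v].
Proof.
move=> dG0 G00.
(* The union with [G0] is part of the property so that the empty chain, whose union is empty,
   satisfies it too. *)
have [|A [PA maxA]] := @Zorn_bigcup _ (fun A => dominated_graph (A `|` G0)).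
  move=> F FP Ftot; split; last first.
    move=> p [[A FA Ap]|Gp]; last exact: dG0.2.
    by apply: (FP _ FA).2; left.
  move=> r p p' [[A FA Ap]|Gp] [[B FB Bp']|Gp'].
  - have [AB|BA] := Ftot _ _ FA FB.
      have [|h|h] := (FP _ FB).1 r p p' _ (or_introl Bp'); first by left;
        exact: AB.
        by left; exists B.
      by right.
    have [|h|h] := (FP _ FA).1 r p p' (or_introl Ap); first by left; exact: BA.
      by left; exists A.
    by right.
  - have [h|h] := (FP _ FA).1 r p p' (or_introl Ap) (or_intror Gp');
      last by right.
    by left; exists A.
  - have [h|h] := (FP _ FB).1 r p p' (or_intror Gp) (or_introl Bp');
      last by right.
    by left; exists B.
  - by right; exact: dG0.1.
pose M := A `|` G0.
have M0 : M (0, 0) by right.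
have total v : exists a, M (v, a).
  have [t dN] := dominated_graph_extend v PA M0.
  set N := [set p | _] in dN.
  have MN : M `<=` N.
    move=> p Mp; exists 0, p; split => //; case: p Mp => p1 p2 _ /=.
    by rewrite of_real0 scale0r mul0r !addr0.
  (* If [v] had no value, the extension [N] would be strictly larger, since it contains [(v, t)]. *)
  apply: contrapT => nv; apply: (maxA N).
    split; first by move=> p Ap; apply: MN; left.
    move=> NA; apply: nv; exists t; left; apply: NA.
    by exists 1, (0, 0); split => //=; rewrite of_real1 scale1r mul1r !add0r.
  rewrite (_ : N `|` G0 = N)//; apply/setUidPl => p Gp; apply: MN; by right.
have uniq v a b : M (v, a) -> M (v, b) -> a = b.
  have le c d : M (v, c) -> M (v, d) -> c <= d.
    move=> Mc Md; have /PA.2 /= := PA.1 (-1) _ _ Md Mc.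
    rewrite of_realN of_real1 scaleN1r addNr -(scale0r 0) -of_real0 qZ_real//
      mul0r.
    by lra.
  by move=> Ma Mb; apply/eqP; rewrite eq_le !le.
have /choice[H HM] := total.
exists H; split=> [r u v|p Gp|v]; last exact: PA.2 (HM v).
  by apply: uniq (HM _) _; exact: PA.1 r _ _ (HM u) (HM v).
by case: p Gp => v a Gp; apply: uniq (HM _) _; right.
Qed.

End HahnBanach.

Lemma real_partD (R : realType) (s : scalars) (a b : scalar_field R s) :
  real_part (a + b) = real_part a + real_part b.
Proof. by rewrite /real_part; move: a b; case: s => //= -[? ?] [? ?]. Qed.

Lemma real_partZ (R : realType) (s : scalars) (r : R) (a : scalar_field R s) :
  real_part (of_real r * a) = r * real_part a.
Proof.
rewrite /real_part /of_real; move: a; case: s => //= -[x y] /=.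
by rewrite mul0r subr0.
Qed.

Lemma real_part_le (R : realType) (s : scalars) (a : scalar_field R s) :
  real_part a <= cabs a.
Proof.
rewrite /cabs /real_part; move: a; case: s => /= [a|[x y]]; first exact: ler_norm.
rewrite (le_trans (ler_norm x))// -sqrtr_sqr ler_sqrt ?lerDl ?sqr_ge0//.
by rewrite addr_ge0 ?sqr_ge0.
Qed.

(* In the complex case the functional with real part [H] is
   [v |-> H v - i H (i v)]. *)
Lemma linear_of_real_part (R : realType) (s : scalars)
    (V : lmodType (scalar_field R s)) (H : V -> R) :
  (forall (r : R) u v, H (of_real r *: u + v) = r * H u + H v) ->
  exists2 G : V -> scalar_field R s,
    forall a u v, G (a *: u + v) = a * G u + G v &
    forall v, real_part (G v) = H v.
Proof.
case: s V H => V H HL; first by exists H.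
have HD u v : H (u + v) = H u + H v.
  by have := HL 1 u v; rewrite of_real1 scale1r mul1r.
have H0 : H 0 = 0 by have := HD 0 0; rewrite addr0; lra.
have HZ (r : R) u : H ((r%:C)%C *: u) = r * H u.
  by have := HL r u 0; rewrite !addr0 H0 addr0.
pose I : R[i] := 'i%C.
exists (fun v => (H v +i* - H (I *: v))%C) => // -[a b] u v.
have -> : (a +i* b)%C *: u = (a%:C)%C *: u + (b%:C)%C *: (I *: u).
  by rewrite scalerA -scalerDl; congr (_ *: _); simpc.
have IC (r : R) w : I *: ((r%:C)%C *: w) = (r%:C)%C *: (I *: w).
  by rewrite !scalerA mulrC.
have II w : I *: (I *: w) = ((- 1)%:C)%C *: w.
  by rewrite scalerA; congr (_ *: _); rewrite /I; simpc.
rewrite !scalerDr !IC II !HD !HZ.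
by apply/eqP; rewrite eq_complex /=; apply/andP; split; apply/eqP; ring.
Qed.

(** In the complex case the imaginary part at [v] is minus the real part at [i v]. *)
Lemma real_part_determines (R : realType) (s : scalars)
    (V : lmodType (scalar_field R s)) (D : set V) (f g : V -> scalar_field R s) :
  (forall a v, D v -> D (a *: v)) ->
  (forall a v, D v -> f (a *: v) = a * f v /\ g (a *: v) = a * g v) ->
  (forall v, D v -> real_part (f v) = real_part (g v)) ->
  forall v, D v -> f v = g v.
Proof.
case: s V D f g => V D f g DZ fgZ fg v Dv; first exact: fg.
have := fg _ (DZ ('i%C : R[i]) v Dv); have := fg _ Dv.
have [-> ->] := fgZ ('i%C : R[i]) v Dv.
case: (f v) (g v) => [a b] [c d] /= -> /eqP.
by rewrite !mul0r !mul1r !sub0r eqr_opp => /eqP ->.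
Qed.

Lemma hahn_banach (R : realType) (s : scalars) (V : lmodType (scalar_field R s))
    (q : V -> R) (D : set V) (g : V -> scalar_field R s) :
  (forall x y, q (x + y) <= q x + q y) ->
  (forall c x, q (c *: x) = cabs c * q x) ->
  D 0 -> (forall a u v, D u -> D v -> D (a *: u + v)) ->
  (forall a u v, D u -> D v -> g (a *: u + v) = a * g u + g v) ->
  (forall v, D v -> cabs (g v) <= q v) ->
  exists G : V -> scalar_field R s,
    [/\ forall a u v, G (a *: u + v) = a * G u + G v,
        forall v, D v -> G v = g v & forall v, cabs (G v) <= q v].
Proof.
move=> qD qZ D0 DL gL gq.
have g0 : g 0 = 0.
  have := gL 1 0 0 D0 D0; rewrite scaler0 addr0 mul1r =>
    /(congr1 (+%R^~ (- g 0))).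
  by rewrite subrr addrK.
pose G0 : set (V * R) := [set p | D p.1 /\ p.2 = real_part (g p.1)].
have [||H [HL HG0 Hq]] := @real_hahn_banach R s V q qD qZ G0.
- split=> [r p p' [Dp ->] [Dp' ->]|p [Dp ->]]; last first.
    by rewrite (le_trans (real_part_le _))// gq.
  by split=> /=; [exact: DL|rewrite gL// real_partD real_partZ].
- by split=> //=; rewrite g0 -(of_real0 (R := R) (s := s)) real_partK.
have [G GL GH] := linear_of_real_part HL.
have G00 : G 0 = 0.
  have := GL 1 0 0; rewrite scaler0 addr0 mul1r => /(congr1 (+%R^~ (- G 0))).
  by rewrite subrr addrK.
have GZ a v : G (a *: v) = a * G v by have := GL a v 0; rewrite !addr0 G00 addr0.
exists G; split=> //.
  apply: real_part_determines => [a v Dv|a v Dv|v Dv].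
  - by rewrite -[_ *: _]addr0; exact: DL.
  - by split; [exact: GZ|rewrite -[_ *: _]addr0 gL// g0 addr0].
  - by rewrite GH (HG0 (v, real_part (g v))).
move=> v; have [Gv0|Gv0] := eqVneq (G v) 0.
  rewrite Gv0 -(of_real0 (R := R) (s := s)) cabs_real normr0.
  have := qD v (- v); rewrite subrr -(scale0r 0) qZ -scaleN1r qZ.
  rewrite -(of_real1 (R := R) (s := s)) -of_realN -of_real0 !cabs_real normr0.
  by rewrite normrN normr1; lra.
(* A phase of modulus one that turns [G v] into its modulus: the bound on the real part at [c *: v]
   then bounds the modulus itself. *)
pose c := of_real (cabs (G v)) / G v.
have cG : c * G v = of_real (cabs (G v)) by rewrite divfK.
have c1 : cabs c = 1.
  rewrite cabsM cabsV cabs_real ger0_norm ?cabs_ge0// divff//.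
  by apply: contra Gv0 => /eqP h; rewrite -normr_eq0 -of_real_cabs h of_real0.
by have := Hq (c *: v); rewrite -GH GZ cG real_partK qZ c1 mul1r.
Qed.

(** On the graph of [i] in [E * Z], the functional [g] is dominated by the seminorm [q]. For an
    extension [G] and [f := G (_, 0)], the error [g z - f (i z)] is [G (0, z)], which [q] bounds by
    [e * rnorm z]. *)
Lemma dual_approximation (R : realType) (s : scalars) (E Z : banach R s)
    (i : Z -> E) (g : Z -> scalar_space R s) (M e : R) :
  0 <= M -> 0 <= e -> linear i -> dual Z g ->
  (forall z, rnorm (g z) <= M * rnorm (i z) + e * rnorm z) ->
  exists2 f, dual E f & forall z, rnorm (f (i z) - g z) <= e * rnorm z.
Proof.
move=> M0 e0 li [lg _] gq.
pose q (v : E * Z) := M * rnorm v.1 + e * rnorm v.2.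
have [||||||G [GL GD Gq]] := @hahn_banach R s (E * Z)%type q
  [set (i z, z) | z in setT] (fun v => sc_val (g v.2)).
- move=> x y; rewrite /q /= addrACA -!mulrDr.
  by rewrite lerD// ler_wpM2l// rnormD.
- by move=> c x; rewrite /q /= !rnormZ; ring.
- by exists 0; rewrite // (lin0 li).
- by move=> a _ _ [u _ <-] [v _ <-]; exists (a *: u + v); rewrite // li.
- by move=> a _ _ [u _ <-] [v _ <-]; rewrite /= lg sc_val_linear.
- by move=> _ [z _ <-]; rewrite cabs_sc_val; exact: gq.
exists (fun x => sc_of (G (x, 0))).
  apply/bounded_operatorP; split.
    move=> a u v; apply: (can_inj sc_valK); rewrite sc_val_linear !sc_ofK -GL.
    by congr G; congr (_, _); rewrite /= scaler0 addr0.
  exists (M + 1) => [|x]; first by rewrite ltr_wpDl.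
  rewrite -cabs_sc_val sc_ofK (le_trans (Gq _))// /q /= rnorm0 mulr0 addr0.
  by rewrite ler_wpM2r ?rnorm_ge0// lerDl.
move=> z; rewrite rdistC -cabs_sc_val sc_valB sc_ofK -(GD (i z, z));
  last by exists z.
rewrite addrC -mulN1r -GL (_ : _ + _ = (0, z)); last first.
  by congr (_, _); rewrite /= scaleN1r ?addNr// oppr0 add0r.
by rewrite (le_trans (Gq _))// /q /= rnorm0 mulr0 add0r.
Qed.

(** * Linear subspaces as vector spaces, and null sequences *)

Section Submodule.
Variables (K : numFieldType) (V : lmodType K) (D : set V).
Hypothesis D0 : D 0.
Hypothesis DL : forall a u v, D u -> D v -> D (a *: u + v).

Let mem_D : {pred V} := fun x => `[< D x >].

Lemma mem_D_closed : submod_closed mem_D.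
Proof.
split; first exact/asboolP.
by move=> a u v /asboolP Du /asboolP Dv; apply/asboolP; exact: DL.
Qed.

HB.instance Definition _ := GRing.isSubmodClosed.Build K V mem_D mem_D_closed.

Record submodule := Submodule {submodule_val : V; _ : submodule_val \in mem_D}.
HB.instance Definition _ := [isSub for submodule_val].
HB.instance Definition _ := [Choice of submodule by <:].
HB.instance Definition _ := [SubChoice_isSubLmodule of submodule by <:].

Lemma submodule_exists : exists (W : lmodType K) (i : W -> V),
  [/\ linear i, injective i & forall x, D x <-> exists w, i w = x].
Proof.
exists (submodule : lmodType K), (val : submodule -> V); split.
- by move=> a u v; rewrite linearP.
- exact: val_inj.
- move=> x; split=> [/asboolP Dx|[[w Dw] <-]]; first by exists (Submodule Dx).
  exact/asboolP.
Qed.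

End Submodule.

(** Convergence to zero for the sequences it is applied to, which are values of seminorms and hence
    nonnegative. *)
Definition vanishing (R : realType) (u : nat -> R) :=
  forall e : R, 0 < e -> exists N, forall n, (N <= n)%N -> u n <= e.

Lemma vanishing_bounded (R : realType) (u : nat -> R) :
  vanishing u -> exists C, forall n, u n <= C.
Proof.
move=> /(_ 1 ltr01)[N uN]; exists (1 + \sum_(n < N) `|u n|) => n.
have [Nn|nN] := leqP N n.
  by rewrite (le_trans (uN _ Nn))// lerDl sumr_ge0.
rewrite (le_trans (ler_norm _))// (bigD1 (Ordinal nN))//=.
by rewrite addrCA lerDl addr_ge0// sumr_ge0.
Qed.

(** * The space of vectors along which a sequence of norms tends to zero *)

Section NullSequenceSpace.
Context {R : realType} {s : scalars} {E : banach R s}.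
Variables (p : nat -> E -> R) (C : nat -> R) (L : R).
Hypothesis pD : forall n x y, p n (x + y) <= p n x + p n y.
Hypothesis pZ : forall n c x, p n (c *: x) = cabs c * p n x.
Hypothesis C_gt0 : forall n, 0 < C n.
Hypothesis pC : forall n x, p n x <= C n * rnorm x.
Hypothesis L_gt0 : 0 < L.
Hypothesis pL : forall x, rnorm x <= L * p 0 x.

Let p0 n : p n 0 = 0.
Proof.
rewrite -(scale0r 0) pZ -(of_real0 (R := R) (s := s)) cabs_real normr0.
by rewrite mul0r.
Qed.

Let pN n x : p n (- x) = p n x.
Proof.
rewrite -scaleN1r pZ -(of_real1 (R := R) (s := s)) -of_realN cabs_real normrN.
by rewrite normr1 mul1r.
Qed.

Let p_ge0 n x : 0 <= p n x.
Proof. by have := pD n x (- x); rewrite subrr p0 pN; lra. Qed.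

(** The second and third clauses say that the norm is the supremum of the [p n]. A Cauchy filter
    converges in [E] because [p 0] controls the norm of [E]; the limit stays in the subspace since
    the convergence is uniform in [n]. *)
Lemma null_sequence_space : exists (Z : banach R s) (i : Z -> E),
  [/\ linear i /\ injective i,
      forall n z, p n (i z) <= rnorm z,
      forall z c, (forall n, p n (i z) <= c) -> rnorm z <= c,
      forall z, vanishing (fun n => p n (i z)) &
      forall x, vanishing (fun n => p n x) -> exists z, i z = x].
Proof.
have [||W [i [li ii iD]]] := @submodule_exists _ E [set x | vanishing (fun n =>
  p n x)].
- by move=> e e0; exists 0%N => n _; rewrite p0 ltW.
- move=> a u v pu pv e e0.
  have a1 : 0 < cabs a + 1 by rewrite ltr_wpDl// cabs_ge0.
  have [N hN] := pu (e / 2 / (cabs a + 1)) (divr_gt0 (divr2_gt0 e0) a1).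
  have [N' hN'] := pv _ (divr2_gt0 e0).
  exists (maxn N N') => n; rewrite geq_max => /andP[/hN pun /hN' pvn].
  rewrite (le_trans (pD _ _ _))// (splitr e) lerD// pZ.
  rewrite (@le_trans _ _ ((cabs a + 1) * p n u))//.
    by rewrite ler_wpM2r// lerDl.
  by rewrite mulrC -ler_pdivlMr.
have iv w : vanishing (fun n => p n (i w)) by apply/iD; exists w.
pose S w := [set p n (i w) | n in setT].
pose N w := sup (S w).
have SC w : has_ubound (S w).
  have [c wc] := vanishing_bounded (iv w).
  by exists c => _ [n _ <-].
have pN_le n w : p n (i w) <= N w by apply: ub_le_sup => //; exists n.
have N_le w c : (forall n, p n (i w) <= c) -> N w <= c.
  by move=> wc; apply: ge_sup; [exists (p 0 (i w)); exists 0%N|move=> _ [n _ <-]].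
have N_ge0 w : 0 <= N w by rewrite (le_trans _ (pN_le 0%N w)).
have NZ_le c w : N (c *: w) <= cabs c * N w.
  by apply: N_le => n; rewrite (linZ li) pZ ler_wpM2l ?cabs_ge0.
have ND u v : N (u + v) <= N u + N v.
  by apply: N_le => n; rewrite (linD li) (le_trans (pD _ _ _))// lerD.
have iN w : rnorm (i w) <= L * N w by rewrite (le_trans (pL _))// ler_wpM2l// ltW.
have NZ c w : N (c *: w) = cabs c * N w.
  apply/eqP; rewrite eq_le NZ_le /=; have [->|c0] := eqVneq c 0.
    by rewrite scale0r -(of_real0 (R := R) (s := s)) cabs_real normr0 mul0r.
  have c1 : 0 < cabs c.
    rewrite lt_neqAle cabs_ge0 andbT eq_sym; apply: contra c0 => /eqP h.
    by rewrite -normr_eq0 -of_real_cabs h of_real0.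
  rewrite mulrC -ler_pdivlMr// mulrC -cabsV.
  by rewrite -[w in leLHS](scalerK c0) NZ_le.
have NN w : N (- w) = N w.
  rewrite -scaleN1r NZ -(of_real1 (R := R) (s := s)) -of_realN cabs_real normrN.
  by rewrite normr1 mul1r.
have NB u v w : N (u - w) <= N (v - u) + N (v - w).
  by rewrite -[N (v - u)]NN opprB (le_trans _ (ND _ _))// addrA subrK.
have [||Z [j [k [lj jk kj jN]]]] := @banach_of_norm R s W N ND NZ.
- move=> w Nw; apply: ii; rewrite (lin0 li); apply: rnorm_eq0.
  by apply/eqP; rewrite eq_le rnorm_ge0 andbT (le_trans (iN w))// Nw mulr0.
- move=> F FF Fc.
  have [|x Fx] := banach_complete (F := i @ F).
    move=> e e0; have [w Fw] := Fc _ (divr_gt0 e0 L_gt0).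
    exists (i w); rewrite nbhs_simpl /=; apply: filterS Fw => y /=.
    rewrite -(linB li) => h; rewrite (le_lt_trans (iN _))//.
    by rewrite mulrC -ltr_pdivlMr.
  (* The element [y'] is chosen after [n], so close to [x] in [E] that [p n (i y' - x) <= e / 3].
     Its distance to [y] is bounded independently of [n], which gives one estimate for all [n]. *)
  have Fp e : 0 < e -> F [set y | forall n, p n (i y - x) <= e].
    move=> e0; have e3 : 0 < e / 3 by rewrite divr_gt0.
    have [w Fw] := Fc _ e3; apply: filterS (Fw) => y /= wy n.
    have := Fx _ (divr_gt0 e3 (C_gt0 n)); rewrite nbhs_simpl /= => Fxn.
    have [y' [/= wy' xy']] := filter_ex (filterI Fw Fxn).
    rewrite -(subrK (i y') (i y)) -addrA (le_trans (pD _ _ _))//.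
    have : p n (i y - i y') <= N (w - y) + N (w - y').
      by rewrite -(linB li) (le_trans (pN_le _ _)).
    have : p n (i y' - x) <= e / 3.
      by rewrite (le_trans (pC _ _))// rdistC mulrC -ler_pdivlMr// ltW.
    by lra.
  have [w wx] : exists w, i w = x.
    apply/iD => e e0; have [y /= yx] := filter_ex (Fp _ (divr2_gt0 e0)).
    have [m hm] := iv y _ (divr2_gt0 e0); exists m => n mn.
    rewrite -(subrK (i y) x) (le_trans (pD _ _ _))// (splitr e).
    by rewrite lerD ?hm// -pN opprB.
  exists w => e e0; apply: filterS (Fp _ (divr2_gt0 e0)) => y /= yx.
  apply: (@le_lt_trans _ _ (e / 2)); last by lra.
  by apply: N_le => n; rewrite (linB li) wx -pN opprB.
have lk : linear k by move=> a u v; apply: (can_inj jk); rewrite kj lj !kj.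
exists Z, (i \o k); split=> /=.
- split; first exact: linear_comp.
  by apply: inj_comp => //; exact: can_inj kj.
- by move=> n z; rewrite -[z in leRHS]kj jN.
- by move=> z c /N_le; rewrite -[z in rnorm z]kj jN.
- by move=> z; exact: iv.
- by move=> x /iD[w <-]; exists (j w); rewrite jk.
Qed.

(* Sliding hump: bounded elements of [Z] that are small in [E] but large under
   [g] could be summed with essentially disjoint supports in the index [n], so
   that the sums stay bounded in [Z]. *)
Lemma null_sequence_space_dual (Z : banach R s) (i : Z -> E) (g : Z ->
  scalar_space R s) (e : R) :
  linear i -> (forall n z, p n (i z) <= rnorm z) ->
  (forall z c, (forall n, p n (i z) <= c) -> rnorm z <= c) ->
  (forall z, vanishing (fun n => p n (i z))) ->
  dual Z g -> 0 < e ->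
  exists2 M, 0 <= M & forall z, rnorm (g z) <= M * rnorm (i z) + e * rnorm z.
Proof.
move=> li pi_le le_pi iv dg e0; apply: contrapT => nM.
have [lg [G G0 gG]] := (bounded_operatorP g).1 dg.
(* A [z] violating the bound for [M := G / eta] satisfies [M * rnorm (i z) < G * rnorm z] and
   [e * rnorm z < rnorm (g z)]. It is then scaled to norm one and rotated so that [g] is real and
   positive there. *)
have hump eta : 0 < eta -> exists z, [/\ rnorm z <= 1, rnorm (i z) <= eta &
    exists2 r, e <= r & sc_val (g z) = of_real r].
  move=> eta0; pose M := G / eta.
  have [z hz] : exists z, M * rnorm (i z) + e * rnorm z < rnorm (g z).
    apply: contrapT => nz; apply: nM; exists M; first by rewrite divr_ge0 ?ltW.
    by move=> z; rewrite leNgt; apply/negP => h; apply: nz; exists z.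
  have z0 : 0 < rnorm z.
    rewrite lt_neqAle rnorm_ge0 andbT eq_sym; apply/negP => /eqP/rnorm_eq0 z0.
    by move: hz; rewrite z0 (lin0 li) (lin0 lg) !rnorm0 !mulr0 addr0 ltxx.
  have gz0 : 0 < rnorm (g z).
    by rewrite (le_lt_trans _ hz)// addr_ge0// mulr_ge0 ?rnorm_ge0 ?divr_ge0//
      ltW.
  pose c := of_real (rnorm (g z) / rnorm z) / sc_val (g z).
  have scg : sc_val (g z) != 0.
    by rewrite -normr_eq0 -of_real_cabs cabs_sc_val -of_real0 (inj_eq
      of_real_inj) gt_eqF.
  have cE : cabs c = (rnorm z)^-1.
    rewrite cabsM cabsV cabs_real cabs_sc_val ger0_norm ?divr_ge0 ?rnorm_ge0//.
    by rewrite mulrAC divff ?mul1r// gt_eqF.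
  exists (c *: z); split.
  - by rewrite rnormZ cE mulVf// gt_eqF.
  - rewrite (linZ li) rnormZ cE ler_pdivrMl// -(ler_pM2l (divr_gt0 G0 eta0)).
    rewrite -/M [leRHS](_ : _ = G * rnorm z); last first.
      by rewrite /M; field; rewrite gt_eqF.
    rewrite (le_trans _ (gG z))// (le_trans _ (ltW hz))// lerDl.
    by rewrite mulr_ge0 ?rnorm_ge0// ltW.
  - exists (rnorm (g z) / rnorm z).
      rewrite ler_pdivlMr// (le_trans _ (ltW hz))// lerDr.
      by rewrite mulr_ge0 ?rnorm_ge0// divr_ge0// ltW.
    rewrite (linZ lg) sc_valZ.
    by rewrite divfK.
(* From the index [N] on, [p n (i w) <= tau]; the new hump is chosen with [p n (i z) <= tau] below
   [N]. At each index only one summand is large, so a hump raises the norm bound by [tau] and the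
   value of [g] by at least [e]. *)
have humps tau m : 0 < tau -> exists w, rnorm w <= 1 + m%:R * tau /\
    exists2 r, m%:R * e <= r & sc_val (g w) = of_real r.
  move=> tau0; elim: m => [|m [w [w1 [r mr gw]]]].
    exists 0; rewrite rnorm0 mul0r addr0 ler01; split => //; exists 0;
      rewrite ?mul0r//.
    by rewrite (lin0 lg) of_real0 sc_val0.
  have [N hN] := iv w _ tau0.
  pose B := 1 + \sum_(n < N) C n.
  have B0 : 0 < B by rewrite ltr_pwDl// sumr_ge0// => n _; rewrite ltW.
  have [z [z1 iz [r' er' gz]]] := hump _ (divr_gt0 tau0 B0).
  exists (w + z); split.
    apply: le_pi => n; rewrite (linD li) (le_trans (pD _ _ _))//.
    rewrite -natr1 mulrDl mul1r; have [Nn|nN] := leqP N n.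
      have := hN _ Nn; have := le_trans (pi_le n z) z1.
      have : 0 <= m%:R * tau by rewrite mulr_ge0// ltW.
      by lra.
    have : p n (i z) <= tau.
      rewrite (le_trans (pC _ _))// (@le_trans _ _ (B * (tau / B)))//; last first.
        by rewrite mulrC divfK// gt_eqF.
      apply: ler_pM; rewrite ?rnorm_ge0 ?(ltW (C_gt0 _))//.
      rewrite /B (bigD1 (Ordinal nN))//= addrCA lerDl addr_ge0// sumr_ge0// =>
        l _.
      by rewrite ltW.
    have := le_trans (pi_le n w) w1; by lra.
  exists (r + r'); first by rewrite -natr1 mulrDl mul1r lerD.
  rewrite -[w]scale1r lg sc_val_linear mul1r gw gz.
  by rewrite of_realD.
(* With [tau = 1 / m] the sum of [m] humps has norm at most [2], while [g] is at least
   [m * e > 2 * G] there. *)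
pose m := (Num.truncn (2 * G / e)).+1.
have m0 : 0 < m%:R :> R by rewrite ltr0n.
have Gm : 2 * G / e < m%:R by exact: truncnS_gt.
have m1 : 0 < m%:R^-1 :> R by rewrite invr_gt0.
have [w [w1 [r mr gw]]] := humps _ m m1.
move: Gm; rewrite ltr_pdivrMr// ltNge => /negP; apply.
rewrite (le_trans mr)// (le_trans (ler_norm r))//.
rewrite -(cabs_real (s := s)) -gw cabs_sc_val (le_trans (gG w))//
  mulrC ler_pM2r//.
by move: w1; rewrite divff ?gt_eqF.
Qed.


End NullSequenceSpace.

(** * Equivalent norms that are small near a finite set *)

Section NetNorm.
Context {R : realType} {s : scalars} {E : banach R s}.
Local Notation K := (scalar_field R s).
Implicit Types (t : seq E) (c : E -> K) (x y : E).

(** The price of writing [x] as a combination of [t] plus a remainder. Coefficients are indexed by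
    the vectors themselves, so repetitions in [t] share one; hence [uniq t] in [net_norm_near]. *)
Definition net_cost t (a b : R) x c :=
  (\sum_(u <- t) cabs (c u)) / a + rnorm (x - \sum_(u <- t) c u *: u) / b.

(* The gauge of the convex hull of the union of [a] times the absolutely convex
   hull of [t] and [b] times the unit ball. *)
Definition net_norm t (a b : R) x := inf [set net_cost t a b x c | c in setT].

Variables (t : seq E) (a b : R).
Hypotheses (a0 : 0 < a) (b0 : 0 < b).
Local Notation p := (net_norm t a b).
Local Notation cost := (net_cost t a b).

Lemma sum_cabs_ge0 c : 0 <= \sum_(u <- t) cabs (c u).
Proof. by apply: sumr_ge0 => u _; exact: cabs_ge0. Qed.

Lemma net_cost_ge0 x c : 0 <= cost x c.
Proof.
by rewrite addr_ge0// divr_ge0 ?rnorm_ge0 ?sum_cabs_ge0// ltW.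
Qed.

Lemma net_norm_le x c : p x <= cost x c.
Proof.
apply: ge_inf; last by exists c.
by exists 0 => _ [d _ <-]; exact: net_cost_ge0.
Qed.

Lemma net_norm_lt x r : p x < r -> exists c, cost x c < r.
Proof.
move=> /inf_lt[|_ [c _ <-]]; last by exists c.
by exists (cost x (fun=> 0)); exists (fun=> 0).
Qed.

Lemma le_net_norm x r : (forall c, r <= cost x c) -> r <= p x.
Proof.
move=> h; apply: lb_le_inf => [|_ [c _ <-]//].
by exists (cost x (fun=> 0)); exists (fun=> 0).
Qed.

Lemma net_normD x y : p (x + y) <= p x + p y.
Proof.
rewrite -lerBlDr; apply: le_net_norm => c; rewrite lerBlDr -lerBlDl.
apply: le_net_norm => d; rewrite lerBlDl.
rewrite (le_trans (net_norm_le _ (fun u => c u + d u)))//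
  /net_cost addrACA -!mulrDl.
rewrite lerD// ler_pM2r ?invr_gt0//.
  by rewrite -big_split ler_sum// => u _; exact: cabsD.
rewrite (le_trans _ (rnormD _ _))// addrACA -opprD -big_split /=.
by rewrite [X in _ <= rnorm (_ - X)](eq_bigr _ (fun u _ =>
  esym (scalerDl _ _ _))).
Qed.

Lemma net_normZ_le k x : p (k *: x) <= cabs k * p x.
Proof.
have [k0|k0] := eqVneq (cabs k) 0.
  rewrite k0 mul0r (le_trans (net_norm_le _ (fun=> 0)))// /net_cost.
  rewrite !big1 => [|u _|u _]; last 2 first.
  - by rewrite scale0r.
  - by rewrite -(of_real0 (R := R) (s := s)) cabs_real normr0.
  by rewrite mul0r add0r subr0 rnormZ k0 !mul0r.
have k1 : 0 < cabs k by rewrite lt_neqAle eq_sym k0 cabs_ge0.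
rewrite -ler_pdivrMl//; apply: le_net_norm => c; rewrite ler_pdivrMl//.
rewrite (le_trans (net_norm_le _ (fun u => k * c u)))// /net_cost.
rewrite mulrDr !mulrA mulr_sumr.
under eq_bigr do rewrite cabsM;
  under [X in rnorm (_ - X)]eq_bigr do rewrite -scalerA.
by rewrite -(scaler_sumr k) -scalerBr rnormZ.
Qed.

Lemma net_normZ k x : p (k *: x) = cabs k * p x.
Proof.
apply/eqP; rewrite eq_le net_normZ_le /=; have [->|k0] := eqVneq k 0.
  rewrite -(of_real0 (R := R) (s := s)) cabs_real normr0 mul0r.
  by apply: le_net_norm => c; exact: net_cost_ge0.
have k1 : 0 < cabs k.
  rewrite lt_neqAle cabs_ge0 andbT eq_sym; apply: contra k0 => /eqP h.
  by rewrite -normr_eq0 -of_real_cabs h of_real0.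
rewrite mulrC -ler_pdivlMr// mulrC -cabsV.
by rewrite -[x in leLHS](scalerK k0) net_normZ_le.
Qed.

Lemma net_norm_le_rnorm x : p x <= b^-1 * rnorm x.
Proof.
rewrite (le_trans (net_norm_le _ (fun=> 0)))// /net_cost !big1 => [|u _|u _];
  last 2 first.
- by rewrite scale0r.
- by rewrite -(of_real0 (R := R) (s := s)) cabs_real normr0.
by rewrite mul0r add0r subr0 mulrC.
Qed.

Lemma rnorm_le_net_norm : exists2 L, 0 < L & forall x, rnorm x <= L * p x.
Proof.
pose m := \sum_(u <- t) rnorm u.
have m0 : 0 <= m by rewrite sumr_ge0// => u _; exact: rnorm_ge0.
(* The combination has norm at most [m] times the sum of the moduli of the coefficients, hence at
   most [a * m] times the first term of the cost; the remainder is [b] times the second. *)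
have L0 : 0 < a * m + b by rewrite ltr_wpDl// mulr_ge0// ltW.
exists (a * m + b) => // x; rewrite -ler_pdivrMl//; apply: le_net_norm => c.
rewrite ler_pdivrMl// /net_cost.
set S := \sum_(u <- t) cabs (c u); set z := \sum_(u <- t) c u *: u.
have S0 : 0 <= S / a by rewrite divr_ge0 ?sum_cabs_ge0// ltW.
have z0 : 0 <= rnorm (x - z) / b by rewrite divr_ge0 ?rnorm_ge0// ltW.
have zS : rnorm z <= S * m.
  apply: (@le_trans _ _ (\sum_(u <- t) cabs (c u) * rnorm u)).
    rewrite /z; elim: (t) => [|u t' IH]; first by rewrite !big_nil rnorm0.
    by rewrite !big_cons (le_trans (rnormD _ _))// rnormZ lerD2l.
  rewrite /S mulr_suml big_seq [leRHS]big_seq ler_sum// => u ut.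
  rewrite ler_wpM2l ?cabs_ge0// /m (big_rem u)//= lerDl.
  by rewrite sumr_ge0// => v _; exact: rnorm_ge0.
have : rnorm x <= rnorm z + rnorm (x - z).
  by rewrite -[x in leLHS](subrK z) addrC rnormD.
have SE : S = S / a * a by rewrite divfK ?gt_eqF.
have xE : rnorm (x - z) = rnorm (x - z) / b * b by rewrite divfK ?gt_eqF.
move: zS S0 z0; rewrite {1}SE {2}xE.
move: (S / a) (_ / b) => u w zS u0 w0.
have : 0 <= a * m * w by rewrite !mulr_ge0// ltW.
have : 0 <= b * u by rewrite mulr_ge0// ltW.
lra.
Qed.

Lemma net_norm_near x u : uniq t -> u \in t -> p x <= a^-1 + b^-1 * rnorm (x - u).
Proof.
move=> ut tu; rewrite (le_trans (net_norm_le _ (fun v => (v == u)%:R)))//.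
rewrite /net_cost (bigD1_seq u)//= [X in rnorm (_ - X)](bigD1_seq u)//= eqxx.
rewrite !big1 => [|v /negPf -> |v /negPf ->]; last 2 first.
- by rewrite scale0r.
- by rewrite mulr0n -(of_real0 (R := R) (s := s)) cabs_real normr0.
rewrite -(of_real1 (R := R) (s := s)) cabs_real normr1 of_real1 scale1r !addr0.
by rewrite mul1r mulrC.
Qed.

End NetNorm.

(** * Existence of admissible spaces *)

Section Grothendieck.
Context {R : realType} {s : scalars}.

Lemma combinations_totally_bounded (E : banach R s) (t : seq E) (M : R) :
  totally_bounded [set \sum_(u <- t) c u *: u |
    c in [set c : E -> scalar_field R s | forall u, u \in t -> cabs (c u) <= M]].
Proof.
elim: t => [|u t IH].
  move=> e e0; exists [:: 0] => _ [c _ <-]; exists 0; first exact: mem_head.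
  by rewrite big_nil subr0 rnorm0.
have dual_id : dual (scalar_space R s) id by exact: bounded_id.
have tu := totally_bounded_image (rank_one_bounded u dual_id)
  (@scalar_ball_totally_bounded R s M).
apply: totally_boundedS
  (totally_bounded_image2 (f := fun x y => x + y) ltr01 _ tu IH).
  move=> _ [c cM <-]; rewrite big_cons; exists (c u *: u).
    exists (sc_of (c u)); last by rewrite sc_ofK.
    by rewrite /= -cabs_sc_val sc_ofK cM ?mem_head.
  exists (\sum_(v <- t) c v *: v) => //; exists c => // v vt.
  by apply: cM; rewrite in_cons vt orbT.
by move=> x x' y y'; rewrite mul1r opprD addrACA rnormD.
Qed.

Lemma admissible_exists (E : banach R s) (K : set E) : totally_bounded K ->
  exists (Z : banach R s) (i : Z -> E), admissible K i.
Proof.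
move=> tK.
(* For a [b n / a n]-net [t n] of [K], the norm [p n] is at most [2 / a n] on [K]. This tends to
   [0], so [K] lies in [Z], and is at most [1] since [a n >= 2], so [K] lies in its unit ball. That
   [b n] tends to [0] makes the inclusion compact. *)
pose a (n : nat) : R := n.+2%:R; pose b (n : nat) : R := n.+1%:R^-1.
have a0 n : 0 < a n by rewrite ltr0n.
have b0 n : 0 < b n by rewrite invr_gt0 ltr0n.
have /choice[t ht] n : exists t : seq E, uniq t /\
    forall x, K x -> exists2 y, y \in t & rnorm (x - y) < b n / a n.
  have [t ht] := tK _ (divr_gt0 (b0 n) (a0 n)); exists (undup t).
  split; first exact: undup_uniq.
  by move=> x /ht[y yt xy]; exists y; rewrite ?mem_undup.
pose p n := net_norm (t n) (a n) (b n).
have pK n x : K x -> p n x <= 2 / a n.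
  move=> Kx; have [y yt xy] := (ht n).2 x Kx.
  rewrite (le_trans (net_norm_near (a0 n) (b0 n) x (ht n).1 yt))//.
  rewrite mulrDl mul1r lerD2l ler_pdivrMl// ltW//.
have inv_small (e : R) : 0 < e -> exists N, forall n,
  (N <= n)%N -> n.+1%:R^-1 <= e.
  move=> e0; exists (Num.truncn e^-1) => n Nn.
  rewrite -[e]invrK lef_pV2 ?posrE ?invr_gt0 ?ltr0n//.
  by rewrite ltW// (lt_le_trans (truncnS_gt _))// ler_nat ltnS.
have [L L0 pL] := rnorm_le_net_norm (t 0%N) (a0 0%N) (b0 0%N).
have pD n := net_normD (t n) (a0 n) (b0 n).
have pZ n := net_normZ (t n) (a0 n) (b0 n).
have pC n := net_norm_le_rnorm (t n) (a0 n) (b0 n).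
have Cgt0 n : 0 < (b n)^-1 by rewrite invr_gt0.
have [Z [i [[li ii] pi_le le_pi iv vi]]] :=
  null_sequence_space pD pZ Cgt0 pC L0 pL.
exists Z, i; split=> //.
- apply/compact_operatorP; split=> // e e0.
  have e4 : 0 < e / 4 by rewrite divr_gt0.
  have [N /(_ N (leqnn N)) bN] := inv_small _ e4.
  have [l hl] := combinations_totally_bounded (t N) (2 * a N) (divr2_gt0 e0).
  exists l => _ [z z1 <-].
  (* A strict bound on the infimum yields actual coefficients: they are below [2 * a N] in modulus,
     and the remainder is below [2 * b N <= e / 2]. *)
  have : net_norm (t N) (a N) (b N) (i z) < 2.
    by rewrite (le_lt_trans (pi_le N z))// (le_lt_trans z1)// ltr1n.
  move=> /net_norm_lt[c zc].
  have S0 := sum_cabs_ge0 (t N) c.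
  have n0 := rnorm_ge0 (i z - \sum_(u <- t N) c u *: u).
  have Sa : 0 <= (\sum_(u <- t N) cabs (c u)) / a N by rewrite divr_ge0// ltW.
  have nb : 0 <= rnorm (i z - \sum_(u <- t N) c u *: u) / b N by rewrite
    divr_ge0// ltW.
  have [|y yl hy] := hl (\sum_(u <- t N) c u *: u).
    exists c => // u ut; apply: (@le_trans _ _ (\sum_(u <- t N) cabs (c u))).
      rewrite (big_rem u)//= lerDl sumr_ge0// => v _; exact: cabs_ge0.
    by rewrite -ler_pdivrMr// ltW// (le_lt_trans _ zc)// lerDl.
  exists y => //; rewrite (le_lt_trans (rdist_triangle (\sum_(u <- t N) c u *:
    u) _ _))//.
  rewrite (splitr e) ler_ltD// (@le_trans _ _ (2 * b N))//.
    by rewrite -ler_pdivrMr// ltW// (le_lt_trans _ zc)// lerDr.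
  by move: bN; rewrite -/(b N); lra.
- move=> x Kx; have [|z zx] := vi x.
    move=> e e0; have [N hN] := inv_small _ (divr2_gt0 e0); exists N => n Nn.
    rewrite (le_trans (pK _ _ Kx))// mulrC -ler_pdivlMr// ?ltr0n//.
    rewrite (le_trans _ (hN _ Nn))// lef_pV2 ?posrE ?ltr0n// ler_nat//.
  exists z => //; apply: le_pi => n; rewrite zx (le_trans (pK n _ Kx))//.
  by rewrite ler_pdivrMr// mul1r ler_nat.
- move=> g dg e e0.
  have [M M0 hM] := null_sequence_space_dual pD Cgt0 pC li pi_le le_pi iv dg
    (divr2_gt0 e0).
  have [f df hf] := dual_approximation M0 (ltW (divr2_gt0 e0)) li dg hM.
  exists f => // z z1; rewrite (le_lt_trans (hf z))//.
  rewrite (@le_lt_trans _ _ (e / 2 * 1)) ?ler_pM2l ?divr2_gt0//; lra.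
Qed.

End Grothendieck.

(** This lets one admissible space serve the finitely many compact sets that define a
    neighbourhood. *)
Lemma totally_bounded_bigcup (R : realType) (s : scalars) (X : banach R s)
    (I : finType) (K : I -> set X) :
  (forall j, totally_bounded (K j)) -> totally_bounded (\bigcup_j K j).
Proof.
move=> tK e e0; have /choice[t ht] j := tK j e e0.
exists (flatten [seq t j | j <- enum I]) => x [j _ /ht[y yt xy]].
exists y => //; apply/flattenP; exists (t j) => //.
by apply: map_f; rewrite mem_enum.
Qed.

(** * Rank one operators in the ideal, and extension of finite rank operators *)

Section RankOne.
Context {R : realType} {s : scalars} (A : quasi_normed_ideal R s).
Implicit Types X Y Z : banach R s.

Lemma rank_one_scalar_ideal X (x : X) :
  ideal_mem A (fun l : scalar_space R s => sc_val l *: x) /\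
  ideal_qnorm A (fun l : scalar_space R s => sc_val l *: x) <= rnorm x.
Proof.
have bx := rank_one_bounded x (bounded_id (scalar_space R s)).
have [Ax xN] := ideal_comp_left bx (ideal_id A).
split=> //; rewrite (le_trans xN)// ideal_qnorm_id mulr1.
apply: opnorm_le => l l1; rewrite rnormZ cabs_sc_val.
by rewrite -[leRHS]mul1r ler_wpM2r ?rnorm_ge0.
Qed.

Lemma rank_one_ideal X Y (g : X -> scalar_space R s) (y : Y) :
  dual X g -> ideal_mem A (fun x => sc_val (g x) *: y).
Proof.
by move=> dg; exact: (ideal_comp_right dg (rank_one_scalar_ideal y).1).1.
Qed.

(** The middle space is the scalar field, whose unit ball is totally bounded, so [g] divided by [d]
    is a compact factor; [d] is moved into the ideal factor. *)
Lemma rank_one_factor X Y (g : X -> scalar_space R s) (y : Y) (d e : R) :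
  dual X g -> 0 < d -> (forall x, unit_ball X x -> rnorm (g x) <= d) ->
  d * rnorm y <= e -> normalized_factor A (fun x => sc_val (g x) *: y) e.
Proof.
move=> dg d0 gd de.
have [Ay Ny] := rank_one_scalar_ideal (of_real d *: y).
exists (scalar_space R s), (fun l => sc_val l *: (of_real d *: y)),
  (fun x => of_real d^-1 *: g x); split.
- split=> //.
    apply/compact_operatorP; split; first exact: (bounded_scale _ dg).1.
    apply: totally_boundedS (@scalar_ball_totally_bounded R s 1) => _ [x x1 <-].
    exact: unit_ball_scale (gd x x1).
  apply/funext => x /=; rewrite sc_valZ scalerA mulrAC -of_realM mulVf ?gt_eqF//.
  by rewrite of_real1 mul1r.
- by move=> x x1; exact: unit_ball_scale (gd x x1).
- by rewrite (le_trans Ny)// rnormZ cabs_real gtr0_norm.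
Qed.

(* A continuous functional on [Z] is a limit of restrictions of functionals on
   [E], so a finite rank operator on [Z] almost extends to [E]. *)
Lemma finite_rank_almost_extends (E Z X : banach R s) (K : set E) (i : Z -> E)
    (S : Z -> X) (e : R) :
  admissible K i -> finite_rank Z X S -> 0 < e ->
  exists S', [/\ finite_rank E X S', ideal_mem A S' &
    normalized_factor A (S' \o i \- S)%R e].
Proof.
move=> [_ /compact_operator_bounded bi _ approx] frS; move: S frS e.
pose P (S : Z -> X) := forall e : R, 0 < e -> exists S',
  [/\ finite_rank E X S', ideal_mem A S' & normalized_factor A (S' \o i \- S)%R
    e].
have P1 g y : dual Z g -> P (fun z => sc_val (g z) *: y).
  move=> dg e e0; have y0 : 0 < rnorm y + 1 by rewrite ltr_wpDl// rnorm_ge0.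
  have [f df fg] := approx g dg _ (divr_gt0 e0 y0).
  exists (fun x => sc_val (f x) *: y); split.
  - exact: finite_rank_one.
  - exact: rank_one_ideal.
  pose h z := f (i z) - g z.
  have dh : dual Z h.
    apply: bounded_add; first exact: (bounded_comp df bi).
    rewrite [X in bounded_operator X](_ : _ = (fun z => (-1) *: g z)).
      exact: bounded_scale.
    by apply/funext => z; rewrite scaleN1r.
  rewrite (_ : _ \- _ = fun z => sc_val (h z) *: y); last first.
    by apply/funext => z; rewrite /h sc_valB scalerBl.
  apply: (rank_one_factor dh (divr_gt0 e0 y0)) => [z /fg/ltW//|].
  by rewrite mulrAC ler_pdivrMr// ler_pM2l// lerDl.
apply: finite_rank_ind => //.
  have := P1 (fun=> 0) 0 (finite_rank0 Z (scalar_space R s)).1.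
  by congr P; apply/funext => z; rewrite scaler0.
have [k k1 kD] := normalized_factorD A.
have k0 : 0 < k by exact: lt_le_trans k1.
move=> S T PS PT e e0; have e' : 0 < e / 2 / k by rewrite !divr_gt0.
have [S' [frS' AS' S'S]] := PS _ e'; have [T' [frT' AT' T'T]] := PT _ e'.
exists (S' \+ T')%R; split; [exact: finite_rankD|exact: ideal_add|].
have := kD _ _ _ _ _ _ S'S T'T.
rewrite (_ : k * _ = e); last by field; rewrite gt_eqF.
congr normalized_factor; apply/funext => z /=.
by rewrite opprD addrACA.
Qed.

End RankOne.

(** * The two implications *)

Theorem theorem6p4 (R : realType) (s : scalars) (A : quasi_normed_ideal R s)
    (X : banach R s) :
  approximation_property A X <->
  (forall Y : banach R s,
     comp_compact A Y X `<=` alpha_kappa_closure A (finite_rank Y X)).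
Proof.
split=> [apX Y T [Z [T1 [T2 [AT1 cT2 ->]]]] e e0|dense Y T AT U].
  have [lT2 tT2] := (compact_operatorP T2).1 cT2.
  (* The seminorm of this one compact set suffices: a space admissible for it contains the image of
     the unit ball under [T2] in its own unit ball. *)
  pose K := closure (T2 @` unit_ball Y).
  have [|S [[AS ST1] frS]] := apX Z T1 AT1
      [set S | ideal_mem A S /\ (norm_on A K (S \- T1)%R < (e / 2)%:E)%E].
    split; first by move=> S [].
    exists 1%N, (fun=> K), (e / 2); split; first by rewrite divr2_gt0.
      by move=> _; exact: cT2.2.
    by move=> S AS /(_ ord0).
  have [_ [W [i [[ii ci Ki _] ->]]] /alpha_normalized_factor fW] :=
    ereal_inf_lt ST1.
  have li := ci.1.
  (* The map lifted through [i] is [- T2], because the neighbourhood controls [S \- T1] while the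
     closure asks for [T1 \o T2 \- S \o T2]. Injectivity of [i] makes the lift linear. *)
  have ball y : unit_ball Y y -> exists2 w, unit_ball W w & i w = - T2 y.
    move=> y1; have /Ki[w w1 wy] : K (T2 (- y)).
      by apply: subset_closure; exists (- y) => //; exact: unit_ballN.
    by exists w => //; rewrite wy (linN lT2).
  have /choice[r hr] y : exists w, i w = - T2 y.
    have y1 : 0 < rnorm y + 1 by rewrite ltr_wpDl// rnorm_ge0.
    have [|w _ wy] := ball (of_real (rnorm y + 1)^-1 *: y).
      by apply: unit_ball_scale => //; rewrite lerDl.
    exists (of_real (rnorm y + 1) *: w).
    by rewrite (linZ li) wy scalerN -(linZ lT2) of_real_scaleK// gt_eqF.
  exists (S \o T2); first exact: finite_rank_comp (compact_operator_bounded cT2).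
  have lr : linear r.
    by move=> a u v; apply: ii; rewrite li !hr lT2 scalerN opprD.
  have r1 y : unit_ball Y y -> unit_ball W (r y).
    by move=> /ball[w w1 wy]; rewrite (_ : r y = w)//; apply: ii; rewrite hr wy.
  have := normalized_factor_alpha (normalized_factor_comp lr r1 fW).
  rewrite (_ : _ \o r = ((T1 \o T2) \- (S \o T2))%R); last first.
    apply/funext => y /=; rewrite hr (linN frS.1.1).
    by rewrite (linN (ideal_bounded AT1).1) opprK addrC.
  move=> /le_lt_trans; apply; rewrite lte_fin; lra.
move=> [UA [n [K [e [e0 cK hU]]]]].
have tK : totally_bounded (\bigcup_j K j).
  by apply: totally_bounded_bigcup => j; exact: compact_totally_bounded.
have [Z [i adm]] := admissible_exists tK; have [ii ci Ki approx] := adm.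
have [k k1 kD] := normalized_factorD A.
have k0 : 0 < k by exact: lt_le_trans k1.
(* Two errors of this size add up, with the constant [k], to [e / 2], strictly below [e]. *)
have e' : 0 < e / 4 / k by rewrite !divr_gt0.
have [|S frS /alpha_normalized_factor TS] := dense Z (T \o i) _ _ e'.
  by exists Y, T, i.
have [S' [frS' AS' S'S]] := finite_rank_almost_extends A adm frS e'.
exists S'; split=> //; apply: hU => // j.
have admj : admissible (K j) i.
  by split=> // x Kx; apply: Ki; exists j.
apply: (@le_lt_trans _ _ (alpha_kappa A ((S' \- T)%R \o i))).
  by apply: ge_ereal_inf; exists (alpha_kappa A ((S' \- T)%R \o i)) => //;
    exists Z, i.
have lTS : linear (T \o i \- S)%R.
  by move=> a u v /=; rewrite ci.1 (ideal_bounded AT).1 frS.1.1 scalerBr opprD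
    addrACA.
(* The two errors are [S' \o i \- S] and the negative of [T \o i \- S]; in their sum [S] cancels. *)
have := normalized_factor_alpha (kD _ _ _ _ _ _ S'S (normalized_factorN lTS TS)).
rewrite (_ : _ \+ _ = (S' \- T)%R \o i); last first.
  by apply/funext => z /=; rewrite opprB addrA subrK.
move=> /le_lt_trans; apply; rewrite lte_fin.
rewrite (_ : k * _ = e / 2); first lra.
by field; rewrite gt_eqF.
Qed.
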